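(* Let $M$ and $N$ be topological spaces, $f:M\to N$ a continuous mapping, $\mathscr{S}$ a sheaf of abelian groups on $M$, and $N'\subset N$ an open subset. Put $M'=f^{-1}(N')$, $f'=f|_{M'}:M'\to N'$ and $\mathscr{S}'=\mathscr{S}|_{M'}$. Then for any $p\ge 0$ and $q\ge 1$ there exists a commutative diagram $$\begin{array}{ccc} H^p\big(N,R^qf_*\mathscr{S}\big) & \xrightarrow{\ d_2\ } & H^{p+2}\big(N,R^{q-1}f_*\mathscr{S}\big)\\ \downarrow & & \downarrow\\ H^p\big(N',R^qf'_*\mathscr{S}'\big) & \xrightarrow{\ d'_2\ } & H^{p+2}\big(N',R^{q-1}f'_*\mathscr{S}'\big) \end{array}$$ where $d_2$ and $d_2'$ are the differentials in the second terms of the Leray spectral sequences associated with the pairs $(\mathscr{S}, f:M\to N)$ and $(\mathscr{S}', f':M'\to N')$ respectively, and the vertical mappings are the restriction mappings from $N$ to $N'$ composed with the natural isomorphisms $(R^if_*\mathscr{S})|_{N'}\simeq R^if'_*\mathscr{S}'$.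
   Context: The Leray spectral sequence of $(\mathscr{S},f:M\to N)$ has $E_2^{p,q}=H^p(N,R^qf_*\mathscr{S})\Rightarrow H^{p+q}(M,\mathscr{S})$. It is constructed as follows. For a sheaf $\mathscr{T}$ of abelian groups let $\mathscr{T}\to\mathscr{A}^0(\mathscr{T})\xrightarrow{\partial}\mathscr{A}^1(\mathscr{T})\xrightarrow{\partial}\cdots$ be its canonical flabby (Godement) resolution: $\mathscr{A}^0(\mathscr{T})$ is the sheaf of discontinuous sections of $\mathscr{T}$, $\mathscr{B}^0(\mathscr{T})=\mathscr{T}$, $\mathscr{A}^p(\mathscr{T})=\mathscr{A}^0(\mathscr{B}^p(\mathscr{T}))$, $\mathscr{B}^{p+1}(\mathscr{T})=\mathscr{A}^p(\mathscr{T})/\mathscr{B}^p(\mathscr{T})$. Put $A^{p,q}=\Gamma(N,\mathscr{A}^p(f_*\mathscr{A}^q(\mathscr{S})))$, with $\partial:A^{p,q}\to A^{p+1,q}$ induced by the canonical resolution of $f_*\mathscr{A}^q(\mathscr{S})$ and $\overline\partial:A^{p,q}\to A^{p,q+1}$ induced by functoriality of $\mathscr{A}^p$ from $f_*\mathscr{A}^q(\mathscr{S})\to f_*\mathscr{A}^{q+1}(\mathscr{S})$. The Leray spectral sequence is the spectral sequence of the double complex $\{A^{p,q},(-1)^{p+q}\partial,\overline\partial\}$ associated with the filtration $F^i(A^n)=\bigoplus_{p+q=n,\,p\ge i}A^{p,q}$, for which $E_2^{p,q}=H^p_\partial(H^q_{\overline\partial}(A^{*,*}))\simeq H^p(N,R^qf_*\mathscr{S})$.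 *)

(* Defs.v *)
From HB Require Import structures.
From mathcomp Require Import all_boot all_order all_algebra.
From mathcomp Require Import all_classical topology.

Set Implicit Arguments.
Unset Strict Implicit.
Unset Printing Implicit Defensive.

Import GRing.Theory.

Local Open Scope classical_set_scope.
Local Open Scope ring_scope.
Local Open Scope quotient_scope.

Definition subz (V : zmodType) (S : zmodClosed V) : Type := {x : V | x \in S}.

HB.instance Definition _ (V : zmodType) (S : zmodClosed V) :=
  SubType.copy (subz S) {x : V | x \in S}.
HB.instance Definition _ (V : zmodType) (S : zmodClosed V) :=
  [Choice of subz S by <:].
HB.instance Definition _ (V : zmodType) (S : zmodClosed V) :=
  [SubChoice_isSubZmodule of subz S by <:].

Definition dprod (I : Type) (G : I -> zmodType) : Type := forall i, G i.

Section Dprod.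
Variables (I : Type) (G : I -> zmodType).
HB.instance Definition _ := Choice.copy (dprod G) (forall i, G i).
Implicit Types s t u : dprod G.
Definition dprod_zero : dprod G := fun=> 0.
Definition dprod_opp s : dprod G := fun i => - s i.
Definition dprod_add s t : dprod G := fun i => s i + t i.
Fact dprod_addA : associative dprod_add.
Proof. by move=> s t u; apply: functional_extensionality_dep => i; apply: addrA. Qed.
Fact dprod_addC : commutative dprod_add.
Proof. by move=> s t; apply: functional_extensionality_dep => i; apply: addrC. Qed.
Fact dprod_add0 : left_id dprod_zero dprod_add.
Proof. by move=> s; apply: functional_extensionality_dep => i; apply: add0r. Qed.
Fact dprod_addN : left_inverse dprod_zero dprod_opp dprod_add.
Proof. by move=> s; apply: functional_extensionality_dep => i; apply: addNr. Qed.
HB.instance Definition _ :=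
  GRing.isZmodule.Build (dprod G) dprod_addA dprod_addC dprod_add0 dprod_addN.
End Dprod.

Section Subgroups.
Variables (V W : zmodType) (f : {additive V -> W}).

Definition kerz : {pred V} := [pred x | f x == 0].
Fact kerz_closed : zmod_closed kerz.
Proof.
split=> [|x y]; rewrite !inE ?raddf0 // raddfB.
by move=> /eqP-> /eqP->; rewrite subrr.
Qed.
HB.instance Definition _ := GRing.isZmodClosed.Build V kerz kerz_closed.

Definition imz : {pred W} := [pred y | `[< exists x, f x = y >]].
Lemma imzP y : reflect (exists x, f x = y) (y \in imz).
Proof. exact: asboolP. Qed.
Fact imz_closed : zmod_closed imz.
Proof.
split=> [|x y]; first by apply/imzP; exists 0; rewrite raddf0.
move=> /imzP[a <-] /imzP[b <-]; apply/imzP; exists (a - b).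
by rewrite raddfB.
Qed.
HB.instance Definition _ := GRing.isZmodClosed.Build W imz imz_closed.

Variable B : zmodClosed W.
Definition preimz : {pred V} := [pred x | f x \in B].
Fact preimz_closed : zmod_closed preimz.
Proof.
by split=> [|x y]; rewrite !inE ?raddf0 ?rpred0 // raddfB; apply: rpredB.
Qed.
HB.instance Definition _ := GRing.isZmodClosed.Build V preimz preimz_closed.
End Subgroups.

Definition zeroz (V : zmodType) : {pred V} := pred1 0.
Fact zeroz_closed (V : zmodType) : zmod_closed (@zeroz V).
Proof. by split=> [|x y]; rewrite !inE // => /eqP-> /eqP->; rewrite subrr. Qed.
HB.instance Definition _ V := GRing.isZmodClosed.Build V (@zeroz V) (@zeroz_closed V).

Section SubMap.
Variables (V W : zmodType) (S : zmodClosed V) (T : zmodClosed W).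
Variables (f : {additive V -> W}) (fS : forall x, x \in S -> f x \in T).
Definition subz_map (x : subz S) : subz T := exist _ (f (val x)) (fS (valP x)).
Fact subz_map_additive : zmod_morphism subz_map.
Proof. by move=> x y; apply: val_inj; rewrite /= !raddfB. Qed.
HB.instance Definition _ :=
  GRing.isZmodMorphism.Build (subz S) (subz T) subz_map subz_map_additive.
End SubMap.

Definition piz (V : zmodType) (B : zmodClosed V) (x : V) : Quotient.quot B :=
  \pi_(Quotient.quot B) x.

Section Piz.
Variables (V : zmodType) (B : zmodClosed V).
Fact piz_additive : zmod_morphism (piz B).
Proof. by move=> x y; rewrite /piz raddfB. Qed.
HB.instance Definition _ :=
  GRing.isZmodMorphism.Build V (Quotient.quot B) (piz B) piz_additive.
Lemma pizP (x : Quotient.quot B) : piz B (repr x) = x.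
Proof. exact: reprK. Qed.
Lemma piz_eqP (x y : V) : reflect (piz B x = piz B y) (x - y \in B).
Proof. by rewrite Quotient.idealrBE; apply: eqP. Qed.
Lemma piz_eq0P (x : V) : reflect (piz B x = 0) (x \in B).
Proof. by rewrite -(raddf0 (piz B)) -{2}[x]subr0; apply: piz_eqP. Qed.
End Piz.

Definition quot_map (V W : zmodType) (B : zmodClosed V) (C : zmodClosed W)
    (f : {additive V -> W}) (fB : forall x, x \in B -> f x \in C)
    (x : Quotient.quot B) : Quotient.quot C :=
  piz C (f (repr x)).

Section QuotMap.
Variables (V W : zmodType) (B : zmodClosed V) (C : zmodClosed W).
Variables (f : {additive V -> W}) (fB : forall x, x \in B -> f x \in C).
Local Notation quot_map := (quot_map fB).
Lemma quot_mapE x : quot_map (piz B x) = piz C (f x).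
Proof. by apply/piz_eqP; rewrite -raddfB fB //; apply/piz_eqP; rewrite pizP. Qed.
Fact quot_map_additive : zmod_morphism quot_map.
Proof.
by move=> x y; rewrite -[x]pizP -[y]pizP -raddfB !quot_mapE -!raddfB.
Qed.
HB.instance Definition _ :=
  GRing.isZmodMorphism.Build (Quotient.quot B) (Quotient.quot C)
    quot_map quot_map_additive.
End QuotMap.

Record cochain := Cochain {
  cgrp :> nat -> zmodType;
  cdiff : forall n, {additive cgrp n -> cgrp n.+1};
  cdiffK : forall n (x : cgrp n), cdiff n.+1 (cdiff n x) = 0 }.

Definition cocycle (K : cochain) (n : nat) : zmodType := subz (kerz (cdiff K n)).

Definition cobound (K : cochain) (n : nat) : zmodClosed (K n) :=
  match n with
  | 0 => @zeroz (K 0) : zmodClosed (K 0)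
  | m.+1 => imz (cdiff K m) : zmodClosed (K m.+1)
  end.

Definition cohomology (K : cochain) (n : nat) : zmodType :=
  Quotient.quot (preimz (val : cocycle K n -> K n) (cobound K n)).

Definition coclass (K : cochain) (n : nat) : {additive cocycle K n -> cohomology K n} :=
  piz _.
Arguments coclass {K n}.

Record chain_map (K L : cochain) := ChainMap {
  chm :> forall n, {additive K n -> L n};
  chm_diff : forall n x, chm n.+1 (cdiff K n x) = cdiff L n (chm n x) }.

Section CohomologyMap.
Variables (K L : cochain) (f : chain_map K L) (n : nat).
Fact chm_kerz x : x \in kerz (cdiff K n) -> f n x \in kerz (cdiff L n).
Proof. by rewrite !inE -chm_diff => /eqP->; rewrite raddf0. Qed.
Definition cocycle_map : {additive cocycle K n -> cocycle L n} :=
  subz_map chm_kerz.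
Fact cobound_map x : x \in cobound K n -> f n x \in cobound L n.
Proof.
case: n x => [|m] x; first by rewrite !inE => /eqP->; rewrite raddf0.
by move=> /imzP[y <-]; apply/imzP; exists (f m y); rewrite chm_diff.
Qed.
Fact cocycle_map_cobound x :
  x \in preimz (val : cocycle K n -> K n) (cobound K n) ->
  cocycle_map x \in preimz (val : cocycle L n -> L n) (cobound L n).
Proof. exact: cobound_map. Qed.
Definition cohomology_map : {additive cohomology K n -> cohomology L n} :=
  quot_map cocycle_map_cobound.
End CohomologyMap.

Record opens (X : topologicalType) := Opens {
  oset :> set X;
  oset_open : open oset }.

Definition opensT (X : topologicalType) : opens X := Opens openT.
Definition opensI (X : topologicalType) (U V : opens X) : opens X :=
  Opens (openI (oset_open U) (oset_open V)).

Lemma opensIl (X : topologicalType) (U V : opens X) : opensI U V `<=` U.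
Proof. exact: subIsetl. Qed.
Lemma opensIr (X : topologicalType) (U V : opens X) : opensI U V `<=` V.
Proof. exact: subIsetr. Qed.

Section OpensPre.
Variables (X Y : topologicalType) (g : continuousType Y X).
Fact preim_open (U : opens X) : open (g @^-1` U).
Proof.
by apply: open_comp (oset_open U) => y _; apply: (@cts_fun _ _ g).
Qed.
Definition opensV (U : opens X) : opens Y := Opens (preim_open U).
End OpensPre.

Record presheaf (X : topologicalType) := Presheaf {
  sec :> opens X -> zmodType;
  res : forall U V : opens X, V `<=` U -> {additive sec U -> sec V};
  res_id : forall (U : opens X) (h : U `<=` U) s, res h s = s;
  res_comp : forall (U V W : opens X) (hUV : V `<=` U) (hVW : W `<=` V)
    (hUW : W `<=` U) s, res hVW (res hUV s) = res hUW s }.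

Definition is_sheaf (X : topologicalType) (F : presheaf X) : Prop :=
  forall (U : opens X) (I : Type) (Ui : I -> opens X)
    (hi : forall i, Ui i `<=` U) (s : forall i, F (Ui i)),
    U `<=` \bigcup_i Ui i ->
    (forall (i j : I) (W : opens X) (hWi : W `<=` Ui i) (hWj : W `<=` Ui j),
      res F hWi (s i) = res F hWj (s j)) ->
    exists! t : F U, forall i, res F (hi i) t = s i.

(* A morphism F -> g_* G (a "g-cohomomorphism" F ~> G), presented by all the
   composites F U -> G (g^-1 U) -> G V for V included in g^-1 U.
   For g = id this is the same as a morphism of presheaves on X. *)
Record comorph (X Y : topologicalType) (g : continuousType Y X)
    (F : presheaf X) (G : presheaf Y) := Comorph {
  cm : forall (U : opens X) (V : opens Y), V `<=` g @^-1` U -> {additive F U -> G V};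
  cm_res : forall (U U' : opens X) (V V' : opens Y) (h : V `<=` g @^-1` U)
    (h' : V' `<=` g @^-1` U') (hU : U' `<=` U) (hV : V' `<=` V) (s : F U),
    res G hV (cm h s) = cm h' (res F hU s) }.

Definition cidfun (X : topologicalType) : continuousType X X := idfun.
Notation psh_morph F G := (comorph (cidfun _) F G).

Definition cmU (X : topologicalType) (F G : presheaf X) (f : psh_morph F G)
  (U : opens X) : {additive F U -> G U} := cm f (@subset_refl _ U).

Section Stalk.
Variables (X : topologicalType) (F : presheaf X) (x : X).

Record pregerm := Pregerm {
  pg_dom : opens X;
  pg_mem : oset pg_dom x;
  pg_sec : F pg_dom }.

HB.instance Definition _ := gen_eqMixin pregerm.
HB.instance Definition _ := gen_choiceMixin pregerm.

Definition same_germ_prop (a b : pregerm) : Prop :=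
  exists (W : opens X) (ha : W `<=` pg_dom a) (hb : W `<=` pg_dom b),
    oset W x /\ res F ha (pg_sec a) = res F hb (pg_sec b).
Definition same_germ : rel pregerm := fun a b => `[< same_germ_prop a b >].

Fact same_germ_equiv : equiv_class_of same_germ.
Proof.
split=> [a|a b|a b c].
- by apply/asboolP; exists (pg_dom a), (@subset_refl _ _), (@subset_refl _ _);
    split=> //; apply: pg_mem.
- by apply/asboolP/asboolP=> -[W [ha [hb [Wx e]]]]; exists W, hb, ha.
- move=> /asboolP[W [hb [ha [Wx e]]]] /asboolP[W' [ha' [hc [Wx' e']]]].
  apply/asboolP.
  have hW : opensI W W' `<=` W by move=> y [].
  have hW' := @opensIr _ W W'.
  exists (opensI W W'), (subset_trans hW hb), (subset_trans hW' hc); split=> //.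
  rewrite -(res_comp hb hW) -(res_comp hc hW') e -e'.
  by rewrite (res_comp ha hW (subset_trans hW ha)) (res_comp ha' hW' (subset_trans hW ha)).
Qed.
Canonical same_germ_equivRel := EquivRelPack same_germ_equiv.
Canonical same_germ_encModRel := defaultEncModRel same_germ.

Definition stalk : Type := {eq_quot same_germ}.
HB.instance Definition _ := Choice.on stalk.
HB.instance Definition _ := EqQuotient.on stalk.

Definition germ (U : opens X) (Ux : oset U x) (s : F U) : stalk :=
  \pi_stalk (Pregerm Ux s).

Lemma germP (U V : opens X) (Ux : oset U x) (Vx : oset V x) (s : F U) (t : F V) :
  germ Ux s = germ Vx t <->
  exists (W : opens X) (hU : W `<=` U) (hV : W `<=` V), oset W x /\ res F hU s = res F hV t.
Proof.
split; first by move/eqP; rewrite piE => /asboolP.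
by move=> h; apply/eqP; rewrite piE; apply/asboolP.
Qed.

Lemma germ_res (U V : opens X) (h : V `<=` U) (Ux : oset U x) (Vx : oset V x) (s : F U) :
  germ Vx (res F h s) = germ Ux s.
Proof.
by apply/germP; exists V, (@subset_refl _ V), h; split; rewrite ?res_id.
Qed.

Lemma stalk_ind (P : stalk -> Prop) :
  (forall (U : opens X) (Ux : oset U x) (s : F U), P (germ Ux s)) -> forall a, P a.
Proof.
by move=> h a; rewrite -[a]reprK; case: (repr a) => U Ux s; apply: h.
Qed.

Lemma stalk_ind2 (P : stalk -> stalk -> Prop) :
  (forall (U : opens X) (Ux : oset U x) (s t : F U), P (germ Ux s) (germ Ux t)) ->
  forall a b, P a b.
Proof.
move=> h; elim/stalk_ind => U Ux s; elim/stalk_ind => V Vx t.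
have hU := @opensIl _ U V.
have hV := @opensIr _ U V.
have Wx : oset (opensI U V) x by [].
by rewrite -(germ_res hU Ux Wx) -(germ_res hV Vx Wx); apply: h.
Qed.

Lemma stalk_ind3 (P : stalk -> stalk -> stalk -> Prop) :
  (forall (U : opens X) (Ux : oset U x) (s t u : F U),
    P (germ Ux s) (germ Ux t) (germ Ux u)) ->
  forall a b c, P a b c.
Proof.
move=> h; apply: (@stalk_ind2 (fun a b => forall c, P a b c)) => U Ux s t.
elim/stalk_ind => V Vx u.
have hU := @opensIl _ U V.
have hV := @opensIr _ U V.
have Wx : oset (opensI U V) x by [].
by rewrite -!(germ_res hU Ux Wx) -(germ_res hV Vx Wx); apply: h.
Qed.

Definition pregerm_add (a b : pregerm) : pregerm :=
  let: Pregerm U Ux s := a in let: Pregerm V Vx t := b in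
  @Pregerm (opensI U V) (conj Ux Vx)
    (res F (@opensIl _ U V) s + res F (@opensIr _ U V) t).
Definition pregerm_opp (a : pregerm) : pregerm :=
  let: Pregerm U Ux s := a in Pregerm Ux (- s).

Definition stalk_zero : stalk := germ (I : oset (opensT X) x) 0.
Definition stalk_opp (a : stalk) : stalk := \pi_stalk (pregerm_opp (repr a)).
Definition stalk_add (a b : stalk) : stalk :=
  \pi_stalk (pregerm_add (repr a) (repr b)).

Lemma stalk_zeroE (U : opens X) (Ux : oset U x) : stalk_zero = germ Ux 0.
Proof. by rewrite /stalk_zero -(germ_res (U := opensT X) (@subsetT _ U) I Ux) raddf0. Qed.

Lemma stalk_oppE (U : opens X) (Ux : oset U x) (s : F U) :
  stalk_opp (germ Ux s) = germ Ux (- s).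
Proof.
rewrite /stalk_opp; case: (repr _) (reprK (germ Ux s)) => V Vx t.
move/germP => [W [hV [hU [Wx e]]]]; apply/germP.
by exists W, hV, hU; split; rewrite // !raddfN e.
Qed.

Lemma stalk_addE (U : opens X) (Ux : oset U x) (s t : F U) :
  stalk_add (germ Ux s) (germ Ux t) = germ Ux (s + t).
Proof.
rewrite /stalk_add.
case: (repr (germ Ux s)) (reprK (germ Ux s)) => V Vx s'.
case: (repr (germ Ux t)) (reprK (germ Ux t)) => V' Vx' t'.
move=> /germP[W' [hV' [hU' [Wx' e']]]] /germP[W [hV [hU [Wx e]]]]; apply/germP.
have hW : opensI W W' `<=` W by move=> y [].
have hW' := @opensIr _ W W'.
have hI : opensI W W' `<=` opensI V V' by move=> y [/hV ? /hV' ?].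
exists (opensI W W'), hI, (subset_trans hW hU); split=> //.
rewrite !raddfD (res_comp _ hI (subset_trans hW hV)).
rewrite (res_comp _ hI (subset_trans hW' hV')) -(res_comp hV hW) -(res_comp hV' hW').
by rewrite e e' (res_comp hU hW (subset_trans hW hU)) (res_comp hU' hW' (subset_trans hW hU)).
Qed.

Fact stalk_addA : associative stalk_add.
Proof.
apply: stalk_ind3 => U Ux s t u.
by rewrite !stalk_addE addrA. Qed.
Fact stalk_addC : commutative stalk_add.
Proof.
apply: stalk_ind2 => U Ux s t.
by rewrite !stalk_addE addrC. Qed.
Fact stalk_add0 : left_id stalk_zero stalk_add.
Proof. by elim/stalk_ind => U Ux s; rewrite (stalk_zeroE Ux) stalk_addE add0r. Qed.
Fact stalk_addN : left_inverse stalk_zero stalk_opp stalk_add.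
Proof.
by elim/stalk_ind => U Ux s; rewrite stalk_oppE stalk_addE addNr (stalk_zeroE Ux).
Qed.
HB.instance Definition _ :=
  GRing.isZmodule.Build stalk stalk_addA stalk_addC stalk_add0 stalk_addN.

Section GermAdditive.
Variables (U : opens X) (Ux : oset U x).
Fact germ_additive : zmod_morphism (germ Ux).
Proof. by move=> s t; rewrite -stalk_addE -stalk_oppE. Qed.
HB.instance Definition _ :=
  GRing.isZmodMorphism.Build (F U) stalk (germ Ux) germ_additive.
End GermAdditive.
End Stalk.

Section StalkMap.
Variables (X Y : topologicalType) (g : continuousType Y X).
Variables (F : presheaf X) (G : presheaf Y) (f : comorph g F G) (y : Y).

Definition stalk_map (a : stalk F (g y)) : stalk G y :=
  let: Pregerm U Uy s := repr a in
  germ (Uy : oset (opensV g U) y) (cm f (@subset_refl _ (opensV g U)) s).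

Lemma stalk_mapE (U : opens X) (V : opens Y) (h : V `<=` g @^-1` U)
    (Ugy : oset U (g y)) (Vy : oset V y) (s : F U) :
  stalk_map (germ Ugy s) = germ Vy (cm f h s).
Proof.
rewrite /stalk_map; case: (repr _) (reprK (germ Ugy s)) => U' Uy' s'.
move=> /germP[W [hU' [hU [Wy e]]]]; apply/germP.
have h1 : opensI V (opensV g W) `<=` opensV g U' by move=> z [_ /hU'].
have h2 : opensI V (opensV g W) `<=` V by move=> z [].
have h3 : opensI V (opensV g W) `<=` g @^-1` W by move=> z [].
exists (opensI V (opensV g W)), h1, h2; split=> //.
by rewrite (cm_res f _ h3 hU') (cm_res f _ h3 hU) e.
Qed.

Fact stalk_map_additive : zmod_morphism stalk_map.
Proof.
apply: stalk_ind2 => U Uy s t.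
have hU := @subset_refl _ (opensV g U).
by rewrite -raddfB !(stalk_mapE hU _ (Uy : oset (opensV g U) y)) !raddfB.
Qed.
HB.instance Definition _ :=
  GRing.isZmodMorphism.Build (stalk F (g y)) (stalk G y) stalk_map stalk_map_additive.
End StalkMap.

Section Disc.
Variables (X : topologicalType) (F : presheaf X).

Definition disc_sec (U : opens X) : zmodType :=
  dprod (fun x : X => dprod (fun _ : oset U x => stalk F x : zmodType) : zmodType).

Definition disc_res (U V : opens X) (h : V `<=` U) (s : disc_sec U) : disc_sec V :=
  fun x Vx => s x (h x Vx).
Fact disc_res_additive (U V : opens X) (h : V `<=` U) : zmod_morphism (disc_res h).
Proof. by []. Qed.
HB.instance Definition _ (U V : opens X) (h : V `<=` U) :=
  GRing.isZmodMorphism.Build (disc_sec U) (disc_sec V) (disc_res h)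
    (disc_res_additive h).

Lemma disc_eq (U : opens X) (s t : disc_sec U) :
  (forall x (Ux : oset U x), s x Ux = t x Ux) -> s = t.
Proof.
move=> e; apply: functional_extensionality_dep => x.
by apply: functional_extensionality_dep => Ux; apply: e.
Qed.

Fact disc_res_id (U : opens X) (h : U `<=` U) s : disc_res h s = s.
Proof. by apply: disc_eq => x Ux; congr (s x _); apply: Prop_irrelevance. Qed.
Fact disc_res_comp (U V W : opens X) (hUV : V `<=` U) (hVW : W `<=` V)
  (hUW : W `<=` U) s : disc_res hVW (disc_res hUV s) = disc_res hUW s.
Proof. by apply: disc_eq => x Ux; congr (s x _); apply: Prop_irrelevance. Qed.

Definition disc : presheaf X :=
  @Presheaf X disc_sec (fun U V h => disc_res h) disc_res_id disc_res_comp.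

Definition disc_germs (U V : opens X) (h : V `<=` idfun @^-1` U) (s : F U) :
  disc_sec V := fun x Vx => germ (h x Vx : oset U x) s.
Fact disc_germs_additive (U V : opens X) (h : V `<=` idfun @^-1` U) :
  zmod_morphism (disc_germs h).
Proof. by move=> s t; apply: disc_eq => x Vx; rewrite /disc_germs raddfB. Qed.
HB.instance Definition _ (U V : opens X) (h : V `<=` idfun @^-1` U) :=
  GRing.isZmodMorphism.Build (F U) (disc_sec V) (disc_germs h)
    (disc_germs_additive h).
Fact disc_unit_res (U U' V V' : opens X) (h : V `<=` idfun @^-1` U)
    (h' : V' `<=` idfun @^-1` U') (hU : U' `<=` U) (hV : V' `<=` V) (s : F U) :
  disc_res hV (disc_germs h s) = disc_germs h' (res F hU s).
Proof. by apply: disc_eq => x Vx; symmetry; apply: germ_res. Qed.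
Definition disc_unit : psh_morph F disc :=
  @Comorph X X (cidfun X) F disc (fun U V h => disc_germs h) disc_unit_res.

Definition locally_germs_prop (U : opens X) (s : disc_sec U) : Prop :=
  forall x, oset U x -> exists (V : opens X) (h : V `<=` U) (t : F V),
    oset V x /\ forall y (Vy : oset V y), s y (h y Vy) = germ Vy t.
Definition locally_germs (U : opens X) : {pred disc_sec U} :=
  fun s => `[< locally_germs_prop s >].
Lemma locally_germsP (U : opens X) (s : disc_sec U) :
  reflect (locally_germs_prop s) (s \in @locally_germs U).
Proof. exact: asboolP. Qed.

Fact locally_germs_closed (U : opens X) : zmod_closed (@locally_germs U).
Proof.
split=> [|s t /locally_germsP hs /locally_germsP ht]; apply/locally_germsP.
  move=> x Ux; exists U, (@subset_refl _ U), 0; split=> // y Uy.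
  by rewrite raddf0.
move=> x Ux; have [V [hV [a [Vx ea]]]] := hs x Ux.
have [W [hW [b [Wx eb]]]] := ht x Ux.
exists (opensI V W), (subset_trans (@opensIl _ V W) hV).
exists (res F (@opensIl _ V W) a - res F (@opensIr _ V W) b); split=> // y [Vy Wy].
rewrite [RHS]raddfB /= (germ_res _ Vy) (germ_res _ Wy) -ea -eb.
by congr (s y _ - t y _); apply: Prop_irrelevance.
Qed.
HB.instance Definition _ U :=
  GRing.isZmodClosed.Build (disc_sec U) (@locally_germs U) (@locally_germs_closed U).

Fact locally_germs_res (U V : opens X) (h : V `<=` U) (s : disc_sec U) :
  s \in @locally_germs U -> disc_res h s \in @locally_germs V.
Proof.
move=> /locally_germsP hs; apply/locally_germsP => x Vx.
have [W [hW [a [Wx ea]]]] := hs x (h x Vx).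
exists (opensI W V), (@opensIr _ W V), (res F (@opensIl _ W V) a).
split=> // y [Wy Vy]; rewrite (germ_res _ Wy) -ea.
by congr (s y _); apply: Prop_irrelevance.
Qed.
End Disc.

Section SubPresheaf.
Variables (X : topologicalType) (F : presheaf X) (S : forall U, zmodClosed (F U)).
Variable (Sres : forall (U V : opens X) (h : V `<=` U) s, s \in S U -> res F h s \in S V).

Definition sub_sec (U : opens X) : zmodType := subz (S U).
Definition sub_res (U V : opens X) (h : V `<=` U) : {additive sub_sec U -> sub_sec V} :=
  subz_map (@Sres U V h).
Fact sub_res_id (U : opens X) (h : U `<=` U) s : sub_res h s = s.
Proof. by apply: val_inj => /=; rewrite res_id. Qed.
Fact sub_res_comp (U V W : opens X) (hUV : V `<=` U) (hVW : W `<=` V)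
  (hUW : W `<=` U) s : sub_res hVW (sub_res hUV s) = sub_res hUW s.
Proof. by apply: val_inj => /=; rewrite (res_comp _ _ hUW). Qed.
Definition sub_presheaf : presheaf X := Presheaf sub_res_id sub_res_comp.
End SubPresheaf.

Section Sheafification.
Variables (X : topologicalType) (F : presheaf X).

(* The families of germs that are locally the germs of a section of F. *)
Definition sheafify : presheaf X :=
  @sub_presheaf X (disc F) (fun U => @locally_germs X F U) (@locally_germs_res X F).

Fact disc_germs_locally (U V : opens X) (h : V `<=` idfun @^-1` U) (s : F U) :
  disc_germs h s \in @locally_germs X F V.
Proof.
apply/locally_germsP => x Vx; exists V, (@subset_refl _ V), (res F h s).
by split=> // y Vy; symmetry; apply: germ_res.
Qed.
Definition sheafify_germs (U V : opens X) (h : V `<=` idfun @^-1` U) (s : F U) :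
  sheafify V := exist _ (disc_germs h s) (disc_germs_locally h s).
Fact sheafify_germs_additive (U V : opens X) (h : V `<=` idfun @^-1` U) :
  zmod_morphism (sheafify_germs h).
Proof. by move=> s t; apply: val_inj => /=; rewrite !raddfB. Qed.
HB.instance Definition _ (U V : opens X) (h : V `<=` idfun @^-1` U) :=
  GRing.isZmodMorphism.Build (F U) (sheafify V) (sheafify_germs h)
    (sheafify_germs_additive h).
Fact sheafify_germs_res (U U' V V' : opens X) (h : V `<=` idfun @^-1` U)
    (h' : V' `<=` idfun @^-1` U') (hU : U' `<=` U) (hV : V' `<=` V) (s : F U) :
  res sheafify hV (sheafify_germs h s) = sheafify_germs h' (res F hU s).
Proof. by apply: val_inj; apply: disc_unit_res. Qed.
Definition sheafify_unit : psh_morph F sheafify :=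
  @Comorph X X (cidfun X) F sheafify (fun U V h => sheafify_germs h) sheafify_germs_res.
End Sheafification.

Section DiscMap.
Variables (X Y : topologicalType) (g : continuousType Y X).
Variables (F : presheaf X) (G : presheaf Y) (f : comorph g F G).

Definition disc_map_sec (U : opens X) (V : opens Y) (h : V `<=` g @^-1` U)
  (s : disc_sec F U) : disc_sec G V := fun y Vy => stalk_map f (s (g y) (h y Vy)).
Fact disc_map_additive (U : opens X) (V : opens Y) (h : V `<=` g @^-1` U) : zmod_morphism (disc_map_sec h).
Proof. by move=> s t; apply: disc_eq => y Vy; rewrite /disc_map_sec !raddfB. Qed.
HB.instance Definition _ (U : opens X) (V : opens Y) (h : V `<=` g @^-1` U) :=
  GRing.isZmodMorphism.Build (disc_sec F U) (disc_sec G V) (disc_map_sec h)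
    (disc_map_additive h).
Fact disc_map_res (U U' : opens X) (V V' : opens Y) (h : V `<=` g @^-1` U)
    (h' : V' `<=` g @^-1` U') (hU : U' `<=` U) (hV : V' `<=` V) (s : disc_sec F U) :
  disc_res hV (disc_map_sec h s) = disc_map_sec h' (disc_res hU s).
Proof.
apply: disc_eq => y Vy; congr (stalk_map f (s _ _)); apply: Prop_irrelevance.
Qed.
Definition disc_map : comorph g (disc F) (disc G) :=
  @Comorph X Y g (disc F) (disc G) (fun U V h => disc_map_sec h) disc_map_res.

Fact disc_map_locally (U : opens X) (V : opens Y) (h : V `<=` g @^-1` U) s :
  s \in @locally_germs X F U -> disc_map_sec h s \in @locally_germs Y G V.
Proof.
move=> /locally_germsP hs; apply/locally_germsP => y Vy.
have [W [hW [t [Wy e]]]] := hs (g y) (h y Vy).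
have hl : opensI (opensV g W) V `<=` g @^-1` W := @opensIl _ _ _.
exists (opensI (opensV g W) V), (@opensIr _ (opensV g W) V), (cm f hl t).
split=> // z [Wz Vz]; rewrite -(stalk_mapE f hl Wz) -e /disc_map_sec.
by congr (stalk_map f (s _ _)); apply: Prop_irrelevance.
Qed.
Definition sheafify_map_sec (U : opens X) (V : opens Y) (h : V `<=` g @^-1` U) :
  {additive sheafify F U -> sheafify G V} := subz_map (@disc_map_locally U V h).
Fact sheafify_map_res (U U' : opens X) (V V' : opens Y) (h : V `<=` g @^-1` U)
    (h' : V' `<=` g @^-1` U') (hU : U' `<=` U) (hV : V' `<=` V) (s : sheafify F U) :
  res (sheafify G) hV (sheafify_map_sec h s) =
  sheafify_map_sec h' (res (sheafify F) hU s).
Proof. by apply: val_inj; apply: disc_map_res. Qed.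
Definition sheafify_map : comorph g (sheafify F) (sheafify G) :=
  @Comorph X Y g _ _ sheafify_map_sec sheafify_map_res.
End DiscMap.

Section Coker.
Variables (X : topologicalType) (F G : presheaf X) (f : psh_morph F G).

Definition coker_sec (U : opens X) : zmodType := Quotient.quot (imz (cmU f U)).
Fact coker_res_im (U V : opens X) (h : V `<=` U) s :
  s \in imz (cmU f U) -> res G h s \in imz (cmU f V).
Proof.
move=> /imzP[t <-]; apply/imzP; exists (res F h t).
by rewrite /cmU (cm_res f _ (@subset_refl _ V) h h).
Qed.
Definition coker_res (U V : opens X) (h : V `<=` U) :
  {additive coker_sec U -> coker_sec V} := quot_map (@coker_res_im U V h).
Fact coker_res_id (U : opens X) (h : U `<=` U) s : coker_res h s = s.
Proof. by rewrite -[s]pizP /= quot_mapE res_id. Qed.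
Fact coker_res_comp (U V W : opens X) (hUV : V `<=` U) (hVW : W `<=` V)
  (hUW : W `<=` U) s : coker_res hVW (coker_res hUV s) = coker_res hUW s.
Proof. by rewrite -[s]pizP /= !quot_mapE (res_comp _ _ hUW). Qed.
Definition coker : presheaf X := Presheaf coker_res_id coker_res_comp.

Definition coker_proj_sec (U V : opens X) (h : V `<=` idfun @^-1` U) (s : G U) :
  coker V := piz _ (res G h s).
Fact coker_proj_additive (U V : opens X) (h : V `<=` idfun @^-1` U) :
  zmod_morphism (coker_proj_sec h).
Proof. by move=> s t; rewrite /coker_proj_sec !raddfB. Qed.
HB.instance Definition _ (U V : opens X) (h : V `<=` idfun @^-1` U) :=
  GRing.isZmodMorphism.Build (G U) (coker V) (coker_proj_sec h)
    (coker_proj_additive h).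
Fact coker_proj_res (U U' V V' : opens X) (h : V `<=` idfun @^-1` U)
    (h' : V' `<=` idfun @^-1` U') (hU : U' `<=` U) (hV : V' `<=` V) (s : G U) :
  coker_res hV (coker_proj_sec h s) = coker_proj_sec h' (res G hU s).
Proof.
rewrite /coker_proj_sec /= quot_mapE (res_comp _ _ (subset_trans h' hU)).
by rewrite (res_comp hU h' (subset_trans h' hU)).
Qed.
Definition coker_proj : psh_morph G coker :=
  @Comorph X X (cidfun X) G coker (fun U V h => coker_proj_sec h) coker_proj_res.
End Coker.

Section CokerMap.
Variables (X Y : topologicalType) (g : continuousType Y X).
Variables (F G : presheaf X) (F' G' : presheaf Y) (f : psh_morph F G) (f' : psh_morph F' G').
Variables (a : comorph g F F') (b : comorph g G G').
Hypothesis comm : forall (U : opens X) (V : opens Y) (h : V `<=` g @^-1` U) (s : F U),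
  cm b h (cmU f U s) = cmU f' V (cm a h s).

Fact coker_map_im (U : opens X) (V : opens Y) (h : V `<=` g @^-1` U) s :
  s \in imz (cmU f U) -> cm b h s \in imz (cmU f' V).
Proof. by move=> /imzP[t <-]; apply/imzP; exists (cm a h t); rewrite comm. Qed.
Definition coker_map_sec (U : opens X) (V : opens Y) (h : V `<=` g @^-1` U) :
  {additive coker f U -> coker f' V} := quot_map (@coker_map_im U V h).
Fact coker_map_res (U U' : opens X) (V V' : opens Y) (h : V `<=` g @^-1` U)
    (h' : V' `<=` g @^-1` U') (hU : U' `<=` U) (hV : V' `<=` V) (s : coker f U) :
  res (coker f') hV (coker_map_sec h s) = coker_map_sec h' (res (coker f) hU s).
Proof. by rewrite -[s]pizP /= !quot_mapE (cm_res b h h' hU hV). Qed.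
Definition coker_map : comorph g (coker f) (coker f') :=
  @Comorph X Y g _ _ coker_map_sec coker_map_res.
End CokerMap.

Section Mcomp.
Variables (X Y : topologicalType) (g : continuousType Y X).
Variables (F : presheaf X) (G H : presheaf Y) (f : comorph g F G) (k : psh_morph G H).
Definition mcomp_sec (U : opens X) (V : opens Y) (h : V `<=` g @^-1` U) :
  {additive F U -> H V} := (cmU k V \o cm f h)%FUN.
Fact mcomp_res (U U' : opens X) (V V' : opens Y) (h : V `<=` g @^-1` U)
    (h' : V' `<=` g @^-1` U') (hU : U' `<=` U) (hV : V' `<=` V) (s : F U) :
  res H hV (mcomp_sec h s) = mcomp_sec h' (res F hU s).
Proof.
rewrite /= /cmU (cm_res k _ (@subset_refl _ V') hV hV).
by rewrite (cm_res f h h' hU hV).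
Qed.
Definition mcomp : comorph g F H := @Comorph X Y g F H mcomp_sec mcomp_res.
End Mcomp.

(* The quotient sheaf A^0(F) / F. *)
Definition godQ (X : topologicalType) (F : presheaf X) : presheaf X :=
  sheafify (coker (disc_unit F)).

Section GodQMap.
Variables (X Y : topologicalType) (g : continuousType Y X).
Variables (F : presheaf X) (G : presheaf Y) (f : comorph g F G).
Lemma disc_unit_nat (U : opens X) (V : opens Y) (h : V `<=` g @^-1` U) (s : F U) :
  cm (disc_map f) h (cmU (disc_unit F) U s) = cmU (disc_unit G) V (cm f h s).
Proof. by apply: disc_eq => y Vy; apply: stalk_mapE. Qed.
Definition godQ_map : comorph g (godQ F) (godQ G) := sheafify_map (coker_map disc_unit_nat).
End GodQMap.

Lemma sheafify_unit_nat (X Y : topologicalType) (g : continuousType Y X)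
    (F : presheaf X) (G : presheaf Y) (f : comorph g F G)
    (U : opens X) (V : opens Y) (h : V `<=` g @^-1` U) (s : F U) :
  cm (sheafify_map f) h (cmU (sheafify_unit F) U s) =
  cmU (sheafify_unit G) V (cm f h s).
Proof. by apply: val_inj; apply: disc_unit_nat. Qed.

(* The Godement resolution: B^0 = F, A^p = A^0 (B^p), B^(p+1) = A^p / B^p. *)
Fixpoint godB (p : nat) (X : topologicalType) (F : presheaf X) : presheaf X :=
  if p is p'.+1 then godQ (godB p' F) else F.
Definition godA (p : nat) (X : topologicalType) (F : presheaf X) : presheaf X :=
  disc (godB p F).

Definition god_proj (p : nat) (X : topologicalType) (F : presheaf X) :
    psh_morph (godA p F) (godB p.+1 F) :=
  mcomp (coker_proj (disc_unit (godB p F))) (sheafify_unit _).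
Definition god_diff (p : nat) (X : topologicalType) (F : presheaf X) :
    psh_morph (godA p F) (godA p.+1 F) :=
  mcomp (god_proj p F) (disc_unit (godB p.+1 F)).

Section GodMap.
Variables (X Y : topologicalType) (g : continuousType Y X).
Variables (F : presheaf X) (G : presheaf Y) (f : comorph g F G).
Fixpoint godB_map (p : nat) : comorph g (godB p F) (godB p G) :=
  if p is p'.+1 then godQ_map (godB_map p') else f.
Definition godA_map (p : nat) : comorph g (godA p F) (godA p G) :=
  disc_map (godB_map p).

Lemma god_proj_nat (p : nat) (U : opens X) (V : opens Y) (h : V `<=` g @^-1` U)
    (s : godA p F U) :
  cm (godB_map p.+1) h (cmU (god_proj p F) U s) =
  cmU (god_proj p G) V (cm (godA_map p) h s).
Proof.
rewrite [LHS]sheafify_unit_nat; congr (cmU (sheafify_unit _) V _).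
rewrite [LHS]quot_mapE; congr (piz _ _).
by rewrite [res _ _ s]res_id [RHS]res_id.
Qed.

Lemma god_diff_nat (p : nat) (U : opens X) (V : opens Y) (h : V `<=` g @^-1` U)
    (s : godA p F U) :
  cm (godA_map p.+1) h (cmU (god_diff p F) U s) =
  cmU (god_diff p G) V (cm (godA_map p) h s).
Proof. by rewrite [LHS]disc_unit_nat god_proj_nat. Qed.
End GodMap.

Lemma god_diffK (p : nat) (X : topologicalType) (F : presheaf X) (U : opens X)
  (s : godA p F U) : cmU (god_diff p.+1 F) U (cmU (god_diff p F) U s) = 0.
Proof.
have e (t : godB p.+1 F U) :
    cmU (god_proj p.+1 F) U (cmU (disc_unit (godB p.+1 F)) U t) = 0.
  rewrite /god_proj {1}/cmU /=.
  have -> : coker_proj_sec (disc_unit (godB p.+1 F)) (@subset_refl _ U)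
      (cmU (disc_unit (godB p.+1 F)) U t) = 0.
    by apply/piz_eq0P; rewrite res_id; apply/imzP; exists t.
  by rewrite raddf0.
have -> : cmU (god_diff p F) U s =
  cmU (disc_unit (godB p.+1 F)) U (cmU (god_proj p F) U s) by [].
rewrite [LHS](_ : _ = cmU (disc_unit (godB p.+2 F)) U
  (cmU (god_proj p.+1 F) U (cmU (disc_unit (godB p.+1 F)) U
    (cmU (god_proj p F) U s)))) //.
by rewrite e raddf0.
Qed.

Record pcomplex (X : topologicalType) := PComplex {
  pk :> nat -> presheaf X;
  pd : forall n, psh_morph (pk n) (pk n.+1);
  pdK : forall n (U : opens X) (s : pk n U), cmU (pd n.+1) U (cmU (pd n) U s) = 0 }.

Record pcomap (X Y : topologicalType) (g : continuousType Y X)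
    (K : pcomplex X) (L : pcomplex Y) := PComap {
  pcm :> forall n, comorph g (K n) (L n);
  pcm_d : forall n (U : opens X) (V : opens Y) (h : V `<=` g @^-1` U) (s : K n U),
    cm (pcm n.+1) h (cmU (pd K n) U s) = cmU (pd L n) V (cm (pcm n) h s) }.

Definition sections (X : topologicalType) (K : pcomplex X) (U : opens X) : cochain :=
  Cochain (fun n s => @pdK X K n U s).

Definition sections_map (X Y : topologicalType) (g : continuousType Y X)
    (K : pcomplex X) (L : pcomplex Y) (f : pcomap g K L)
    (U : opens X) (V : opens Y) (h : V `<=` g @^-1` U) :
    chain_map (sections K U) (sections L V) :=
  @ChainMap (sections K U) (sections L V) (fun n => cm (f n) h)
    (fun n s => pcm_d f h s).

Fact sections_res_diff (X : topologicalType) (K : pcomplex X) (U V : opens X)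
    (h : V `<=` U) n (s : K n U) :
  res (K n.+1) h (cmU (pd K n) U s) = cmU (pd K n) V (res (K n) h s).
Proof. by rewrite /cmU (cm_res (pd K n) _ (@subset_refl _ V) h h). Qed.
Definition sections_res (X : topologicalType) (K : pcomplex X) (U V : opens X)
    (h : V `<=` U) : chain_map (sections K U) (sections K V) :=
  @ChainMap (sections K U) (sections K V) (fun n => res (K n) h)
    (fun n s => sections_res_diff h s).

Definition godement (X : topologicalType) (F : presheaf X) : pcomplex X :=
  PComplex (fun p U s => @god_diffK p X F U s).

Definition godement_map (X Y : topologicalType) (g : continuousType Y X)
    (F : presheaf X) (G : presheaf Y) (f : comorph g F G) :
    pcomap g (godement F) (godement G) :=
  @PComap X Y g (godement F) (godement G) (godA_map f)
    (fun p U V h s => @god_diff_nat X Y g F G f p U V h s).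

Definition sheaf_coh (p : nat) (X : topologicalType) (F : presheaf X) : zmodType :=
  cohomology (sections (godement F) (opensT X)) p.

Definition sheaf_coh_map (p : nat) (X Y : topologicalType) (g : continuousType Y X)
    (F : presheaf X) (G : presheaf Y) (f : comorph g F G) :
    {additive sheaf_coh p F -> sheaf_coh p G} :=
  cohomology_map (sections_map (godement_map f)
    ((fun _ _ => I) : opensT Y `<=` g @^-1` opensT X)) p.

Section CohPresheaf.
Variables (X : topologicalType) (K : pcomplex X) (q : nat).

Definition coh_sec (U : opens X) : zmodType := cohomology (sections K U) q.
Definition coh_res (U V : opens X) (h : V `<=` U) : {additive coh_sec U -> coh_sec V} :=
  cohomology_map (sections_res K h) q.
Fact coh_res_id (U : opens X) (h : U `<=` U) s : coh_res h s = s.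
Proof.
rewrite -[s]pizP [LHS]quot_mapE; congr (piz _ _).
by apply: val_inj; apply: res_id.
Qed.
Fact coh_res_comp (U V W : opens X) (hUV : V `<=` U) (hVW : W `<=` V)
  (hUW : W `<=` U) s : coh_res hVW (coh_res hUV s) = coh_res hUW s.
Proof.
rewrite -[s]pizP [coh_res hUV _]quot_mapE [LHS]quot_mapE [RHS]quot_mapE.
by congr (piz _ _); apply: val_inj; apply: res_comp.
Qed.
Definition coh_presheaf : presheaf X := Presheaf coh_res_id coh_res_comp.
Definition coh_sheaf : presheaf X := sheafify coh_presheaf.

Fact cocycle_res (U V : opens X) (h : V `<=` U) (s : K q U) :
  s \in kerz (cmU (pd K q) U) -> res (K q) h s \in kerz (cmU (pd K q) V).
Proof. by rewrite !inE -sections_res_diff => /eqP->; rewrite raddf0. Qed.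
Definition cocycle_presheaf : presheaf X :=
  @sub_presheaf X (K q) (fun U => kerz (cmU (pd K q) U)) cocycle_res.

Definition cocycle_incl_sec (U V : opens X) (h : V `<=` idfun @^-1` U)
  (s : cocycle_presheaf U) : K q V := res (K q) h (val s).
Fact cocycle_incl_additive (U V : opens X) (h : V `<=` idfun @^-1` U) :
  zmod_morphism (cocycle_incl_sec h).
Proof. by move=> s t; rewrite /cocycle_incl_sec !raddfB. Qed.
HB.instance Definition _ (U V : opens X) (h : V `<=` idfun @^-1` U) :=
  GRing.isZmodMorphism.Build (cocycle_presheaf U) (K q V) (cocycle_incl_sec h)
    (cocycle_incl_additive h).
Fact cocycle_incl_res (U U' V V' : opens X) (h : V `<=` idfun @^-1` U)
    (h' : V' `<=` idfun @^-1` U') (hU : U' `<=` U) (hV : V' `<=` V)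
    (s : cocycle_presheaf U) :
  res (K q) hV (cocycle_incl_sec h s) =
  cocycle_incl_sec h' (res cocycle_presheaf hU s).
Proof.
by rewrite /cocycle_incl_sec /= !(res_comp _ _ (subset_trans hV h)).
Qed.
Definition cocycle_incl : psh_morph cocycle_presheaf (K q) :=
  @Comorph X X (cidfun X) cocycle_presheaf (K q)
    (fun U V h => cocycle_incl_sec h) cocycle_incl_res.

Definition cocycle_class_sec (U V : opens X) (h : V `<=` idfun @^-1` U)
  (s : cocycle_presheaf U) : coh_presheaf V :=
  @coclass (sections K V) q (res cocycle_presheaf h s).
Fact cocycle_class_additive (U V : opens X) (h : V `<=` idfun @^-1` U) :
  zmod_morphism (cocycle_class_sec h).
Proof. by move=> s t; rewrite /cocycle_class_sec !raddfB. Qed.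
HB.instance Definition _ (U V : opens X) (h : V `<=` idfun @^-1` U) :=
  GRing.isZmodMorphism.Build (cocycle_presheaf U) (coh_presheaf V)
    (cocycle_class_sec h) (cocycle_class_additive h).
Fact cocycle_class_res (U U' V V' : opens X) (h : V `<=` idfun @^-1` U)
    (h' : V' `<=` idfun @^-1` U') (hU : U' `<=` U) (hV : V' `<=` V)
    (s : cocycle_presheaf U) :
  coh_res hV (cocycle_class_sec h s) =
  cocycle_class_sec h' (res cocycle_presheaf hU s).
Proof.
rewrite [LHS]quot_mapE; congr (piz _ _).
by apply: val_inj; rewrite /= !(res_comp _ _ (subset_trans hV h)).
Qed.
Definition cocycle_class : psh_morph cocycle_presheaf coh_presheaf :=
  @Comorph X X (cidfun X) cocycle_presheaf coh_presheaf
    (fun U V h => cocycle_class_sec h) cocycle_class_res.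
Definition cocycle_proj : psh_morph cocycle_presheaf coh_sheaf :=
  mcomp cocycle_class (sheafify_unit coh_presheaf).
End CohPresheaf.

Section CohSheafMap.
Variables (X Y : topologicalType) (g : continuousType Y X).
Variables (K : pcomplex X) (L : pcomplex Y) (f : pcomap g K L) (q : nat).
Fact coh_presheaf_map_res (U U' : opens X) (V V' : opens Y) (h : V `<=` g @^-1` U)
    (h' : V' `<=` g @^-1` U') (hU : U' `<=` U) (hV : V' `<=` V)
    (s : coh_presheaf K q U) :
  res (coh_presheaf L q) hV (cohomology_map (sections_map f h) q s) =
  cohomology_map (sections_map f h') q (res (coh_presheaf K q) hU s).
Proof.
rewrite -[s]pizP [cohomology_map _ _ _]quot_mapE.
rewrite [res (coh_presheaf K q) _ _]quot_mapE.
rewrite [LHS]quot_mapE [RHS]quot_mapE.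
by congr (piz _ _); apply: val_inj; apply: cm_res.
Qed.
Definition coh_presheaf_map : comorph g (coh_presheaf K q) (coh_presheaf L q) :=
  @Comorph X Y g (coh_presheaf K q) (coh_presheaf L q)
    (fun U V h => cohomology_map (sections_map f h) q)
    coh_presheaf_map_res.
Definition coh_sheaf_map : comorph g (coh_sheaf K q) (coh_sheaf L q) :=
  sheafify_map coh_presheaf_map.
End CohSheafMap.

Fact opensV_mono (X Y : topologicalType) (g : continuousType Y X) (U V : opens X) :
  V `<=` U -> opensV g V `<=` opensV g U.
Proof. by move=> h y; apply: h. Qed.

Definition direct_image (M N : topologicalType) (f : continuousType M N) (F : presheaf M) :
    presheaf N :=
  @Presheaf N (fun U => F (opensV f U)) (fun U V h => res F (opensV_mono h))
    (fun U h s => res_id _ s)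
    (fun U V W hUV hVW hUW s => res_comp _ _ (opensV_mono hUW) s).

Section PushMap.
Variables (M N M' N' : topologicalType).
Variables (f : continuousType M N) (f' : continuousType M' N').
Variables (gM : continuousType M' M) (gN : continuousType N' N).
Hypothesis sq : forall x, f (gM x) = gN (f' x).

Fact direct_image_pre (U : opens N) (V : opens N') :
  V `<=` gN @^-1` U -> opensV f' V `<=` gM @^-1` (opensV f U).
Proof. by move=> h x /h; rewrite /preimage /= sq. Qed.

Definition direct_image_comorph (F : presheaf M) (F' : presheaf M') (a : comorph gM F F') :
    comorph gN (direct_image f F) (direct_image f' F') :=
  @Comorph N N' gN (direct_image f F) (direct_image f' F') (fun U V h => cm a (direct_image_pre h))
    (fun U U' V V' h h' hU hV s =>
      cm_res a (direct_image_pre h) (direct_image_pre h') (opensV_mono hU) (opensV_mono hV) s).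

End PushMap.

Definition direct_image_morph (M N : topologicalType) (f : continuousType M N)
    (F G : presheaf M) (a : psh_morph F G) : psh_morph (direct_image f F) (direct_image f G) :=
  @direct_image_comorph M N M N f f (cidfun M) (cidfun N) (fun=> erefl) F G a.

Lemma direct_image_morphE (M N : topologicalType) (f : continuousType M N)
    (F G : presheaf M) (a : psh_morph F G) (U : opens N) (s : direct_image f F U) :
  cmU (direct_image_morph f a) U s = cmU a (opensV f U) s.
Proof. by rewrite /cmU /=; congr (cm a _ s); apply: Prop_irrelevance. Qed.

Section PushComplex.
Variables (M N : topologicalType) (f : continuousType M N) (K : pcomplex M).
Fact direct_image_complexK n (U : opens N) (s : direct_image f (K n) U) :
  cmU (direct_image_morph f (pd K n.+1)) U (cmU (direct_image_morph f (pd K n)) U s) = 0.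
Proof. by rewrite !direct_image_morphE; apply: pdK. Qed.
Definition direct_image_complex : pcomplex N := PComplex direct_image_complexK.
End PushComplex.

Section PushComplexMap.
Variables (M N M' N' : topologicalType).
Variables (f : continuousType M N) (f' : continuousType M' N').
Variables (gM : continuousType M' M) (gN : continuousType N' N).
Hypothesis sq : forall x, f (gM x) = gN (f' x).
Variables (K : pcomplex M) (L : pcomplex M') (a : pcomap gM K L).
Fact direct_image_complex_map_d n (U : opens N) (V : opens N') (h : V `<=` gN @^-1` U)
    (s : direct_image f (K n) U) :
  cm (direct_image_comorph sq (a n.+1)) h (cmU (direct_image_morph f (pd K n)) U s) =
  cmU (direct_image_morph f' (pd L n)) V (cm (direct_image_comorph sq (a n)) h s).
Proof. by rewrite !direct_image_morphE; apply: pcm_d. Qed.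
Definition direct_image_complex_map : pcomap gN (direct_image_complex f K) (direct_image_complex f' L) :=
  @PComap N N' gN (direct_image_complex f K) (direct_image_complex f' L)
    (fun n => direct_image_comorph sq (a n)) direct_image_complex_map_d.
End PushComplexMap.

(* R^q f_* S as the cohomology sheaf H^q (f_* A^*(S)), that is, the sheaf associated
   with V |-> H^q (Gamma (f^-1 V, A^*(S))). *)
Definition leray_complex (M N : topologicalType) (f : continuousType M N)
    (S : presheaf M) : pcomplex N :=
  direct_image_complex f (godement S).
Definition higher_image (M N : topologicalType) (f : continuousType M N)
    (S : presheaf M) (q : nat) : presheaf N :=
  coh_sheaf (leray_complex f S) q.

Section OpenSubspace.
Variables (X : topologicalType) (U : opens X).

Definition subsp : topologicalType := set_type (oset U).

Fact subsp_val_continuous : continuous (set_val : subsp -> X).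
Proof. exact: initial_continuous. Qed.
Definition subsp_incl : continuousType subsp X := mkcts subsp_val_continuous.

Fact subsp_img_open (V : opens subsp) : open (subsp_incl @` V).
Proof.
have [W oW e] : exists2 W : set X, open W & set_val @^-1` W = V.
  by have [W oW e] := oset_open V; exists W.
rewrite (_ : _ @` _ = W `&` U); first exact: openI oW (oset_open U).
apply/seteqP; split=> [_ [x Vx <-]|x [Wx Ux]].
  by split; [move: Vx; rewrite -e | apply: set_valP].
by exists (exist _ x (mem_set Ux)); rewrite // -e.
Qed.
Definition subsp_img (V : opens subsp) : opens X := Opens (subsp_img_open V).

Fact subsp_img_mono (V W : opens subsp) : W `<=` V -> subsp_img W `<=` subsp_img V.
Proof. by move=> h; apply: image_subset. Qed.

Section Restrict.
Variable F : presheaf X.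

Definition open_restr : presheaf subsp :=
  @Presheaf subsp (fun V => F (subsp_img V)) (fun V W h => res F (subsp_img_mono h))
    (fun V h s => res_id _ s)
    (fun V V' W h h' h'' s => res_comp _ _ (subsp_img_mono h'') s).

Fact subsp_img_sub (V : opens X) (W : opens subsp) :
  W `<=` subsp_incl @^-1` V -> subsp_img W `<=` V.
Proof. by move=> h _ [x Wx <-]; apply: h. Qed.

Definition open_restr_unit : comorph subsp_incl F open_restr :=
  @Comorph X subsp subsp_incl F open_restr (fun V W h => res F (subsp_img_sub h))
    (fun V V' W W' h h' hV hW s =>
      etrans (res_comp (subsp_img_sub h) (subsp_img_mono hW)
                (subset_trans (subsp_img_sub h') hV) s)
        (esym (res_comp hV (subsp_img_sub h') _ s))).

(* A morphism F ~> G over the inclusion of U is the same as a morphism F|_U -> G *)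
Variables (G : presheaf subsp) (a : comorph subsp_incl F G).
Fact open_restr_descend_sub (V W : opens subsp) :
  W `<=` idfun @^-1` V -> W `<=` subsp_incl @^-1` (subsp_img V).
Proof. by move=> h x Wx; exists x => //; apply: h. Qed.
Definition open_restr_descend : psh_morph open_restr G :=
  @Comorph subsp subsp (cidfun subsp) open_restr G
    (fun V W h => cm a (open_restr_descend_sub h))
    (fun V V' W W' h h' hV hW s =>
      cm_res a (open_restr_descend_sub h) (open_restr_descend_sub h')
        (subsp_img_mono hV) hW s).
End Restrict.
End OpenSubspace.

Section RestrictMap.
Variables (M N : topologicalType) (f : continuousType M N) (N' : opens N).

Fact restrict_fun_mem (x : subsp (opensV f N')) : f (val x) \in (N' : set N).
Proof. by apply: mem_set; apply: (set_valP x). Qed.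
Definition restrict_fun (x : subsp (opensV f N')) : subsp N' :=
  exist _ (f (val x)) (restrict_fun_mem x).
Fact restrict_fun_continuous : continuous restrict_fun.
Proof.
apply/continuousP => _ [W oW <-].
exists (f @^-1` W) => //.
by apply: open_comp oW => x _; apply: (@cts_fun _ _ f).
Qed.
Definition restrict_map : continuousType (subsp (opensV f N')) (subsp N') :=
  mkcts restrict_fun_continuous.

Fact restrict_mapE (x : subsp (opensV f N')) :
  f (subsp_incl (opensV f N') x) = subsp_incl N' (restrict_map x).
Proof. by []. Qed.

Variable S : presheaf M.
Local Notation S' := (open_restr (opensV f N') S).

Definition higher_image_res (q : nat) :
    comorph (subsp_incl N') (higher_image f S q) (higher_image restrict_map S' q) :=
  coh_sheaf_map (direct_image_complex_map restrict_mapE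
    (godement_map (open_restr_unit (opensV f N') S))) q.

(* The natural isomorphism (R^q f_* S)|_N' -> R^q f'_* S', given on an open V of N' by
   the restrictions A^q(S)(f^-1 V) -> A^q(S')(f'^-1 V); it is an isomorphism by
   [higher_image_iso_bijective]. *)
Definition higher_image_iso (q : nat) :
    psh_morph (open_restr N' (higher_image f S q)) (higher_image restrict_map S' q) :=
  open_restr_descend (higher_image_res q).

Definition leray_restriction (p q : nat) :
    {additive sheaf_coh p (higher_image f S q) ->
              sheaf_coh p (higher_image restrict_map S' q)} :=
  (sheaf_coh_map p (higher_image_iso q) \o
   sheaf_coh_map p (open_restr_unit N' (higher_image f S q)))%FUN.
End RestrictMap.

Section OpenIso.
Variables (X : topologicalType) (U : opens X).
Local Notation j := (subsp_incl U).

Definition isoz (V W : zmodType) (f : {additive V -> W}) : Prop :=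
  (forall x, f x = 0 -> x = 0) /\ (forall y, exists x, f x = y).

Lemma isoz_bijective (V W : zmodType) (f : {additive V -> W}) : isoz f -> bijective f.
Proof.
move=> [inj surj]; have [g gK] := choice surj; exists g => // x.
by apply/eqP; rewrite -subr_eq0; apply/eqP/inj; rewrite raddfB gK subrr.
Qed.

(* The induced morphism F|_U -> G is an isomorphism *)
Definition open_iso (F : presheaf X) (G : presheaf (subsp U)) (a : comorph j F G) :=
  forall V : opens (subsp U), isoz (cmU (open_restr_descend a) V).

Lemma subsp_incl_inj : injective j.
Proof. exact: val_inj. Qed.

Section OpenIsoFacts.
Variables (F : presheaf X) (G : presheaf (subsp U)) (a : comorph j F G).
Hypothesis isoa : open_iso a.

Lemma open_iso_bij (V : opens (subsp U)) (h : V `<=` j @^-1` (subsp_img V)) :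
  isoz (cm a h).
Proof.
by rewrite (_ : h = open_restr_descend_sub (@subset_refl _ V));
  [apply: isoa | apply: Prop_irrelevance].
Qed.

Lemma open_iso_stalk (y : subsp U) : isoz (stalk_map a (y:=y)).
Proof.
split=> /=.
  elim/stalk_ind => W Wy s.
  have hW : subsp_img (opensV j W) `<=` W by move=> _ [z Wz <-].
  have Wy' : oset (subsp_img (opensV j W)) (j y) by exists y.
  rewrite -(germ_res hW Wy Wy') (stalk_mapE a (open_restr_descend_sub (@subset_refl _ (opensV j W))) _ (Wy : oset (opensV j W) y)).
  move: (res F hW s) => {}s.
  rewrite -(raddf0 (germ (Wy : oset (opensV j W) y))) => /germP[V [h [h' [Vy]]]].
  rewrite raddf0 (cm_res a _ (open_restr_descend_sub (@subset_refl _ V)) (subsp_img_mono h)).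
  move=> /(open_iso_bij _).1 e.
  have Vy' : oset (subsp_img V) (j y) by exists y.
  by rewrite -(germ_res (subsp_img_mono h) Wy' Vy') e raddf0.
elim/stalk_ind => V Vy t.
have hV := open_restr_descend_sub (@subset_refl _ V).
have [s <-] := (open_iso_bij hV).2 t.
have Vy' : oset (subsp_img V) (j y) by exists y.
by exists (germ Vy' s); rewrite (stalk_mapE a hV Vy' Vy).
Qed.

Lemma open_iso_disc : open_iso (disc_map a).
Proof.
move=> V; split=> [s e|t].
  apply: disc_eq => x Ux; have [y Vy yx] := Ux; move: Ux; rewrite -yx => Ux.
  apply: (open_iso_stalk y).1.
  have := congr1 (fun u : disc_sec G V => u y Vy) e.
  rewrite [LHS](_ : _ = stalk_map a (s (j y) Ux)) //.
  by congr (stalk_map a (s _ _)); apply: Prop_irrelevance.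
have ex (x : X) (Vx : oset (subsp_img V) x) : exists b : stalk F x,
    forall y (Vy : oset V y) (e : x = j y), stalk_map a (ecast z (stalk F z) e b) = t y Vy.
  have [y Vy yx] := Vx; case: x / yx Vx => Vx.
  have [b eb] := (open_iso_stalk y).2 (t y Vy).
  exists b => y' Vy' e; have ey := subsp_incl_inj e.
  case: y' / ey Vy' e => Vy' e; rewrite (Prop_irrelevance e erefl) /= eb.
  by congr (t y _); apply: Prop_irrelevance.
exists (fun x Vx => projT1 (cid (ex x Vx))); apply: disc_eq => y Vy.
by rewrite -(projT2 (cid (ex (j y) (open_restr_descend_sub (@subset_refl _ V) Vy))) y Vy erefl).
Qed.

Lemma open_iso_sheafify : open_iso (sheafify_map a).
Proof.
move=> V; split=> [s e|t].
  by apply: val_inj; apply: (open_iso_disc V).1; move: e => /(congr1 val).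
have [s es] := (open_iso_disc V).2 (val t).
have hs : s \in @locally_germs X F (subsp_img V).
  apply/locally_germsP => _ [y Vy <-].
  have /locally_germsP/(_ y Vy)[W [hW [u [Wy eu]]]] := valP t.
  have hh := open_restr_descend_sub (@subset_refl _ W).
  have [s0 es0] := (open_iso_bij hh).2 u.
  exists (subsp_img W), (subsp_img_mono hW), s0; split; first by exists y.
  move=> x Wx; have [z Wz zx] := Wx; case: x / zx Wx => Wx.
  apply/eqP; rewrite -subr_eq0; apply/eqP; apply: (open_iso_stalk z).1.
  have E : stalk_map a (germ Wx s0) = germ Wz u.
    by rewrite (stalk_mapE a hh Wx Wz) es0.
  apply/eqP; rewrite raddfB subr_eq0; apply/eqP; apply: etrans (esym E).
  rewrite -eu -es.
  by congr (stalk_map a (s _ _)); apply: Prop_irrelevance.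
by exists (exist _ s hs); apply: val_inj.
Qed.
End OpenIsoFacts.

Lemma open_iso_coker (F F1 : presheaf X) (G G1 : presheaf (subsp U))
    (f : psh_morph F F1) (f' : psh_morph G G1) (a : comorph j F G) (b : comorph j F1 G1)
    (comm : forall (V : opens X) W (h : (W : opens (subsp U)) `<=` j @^-1` V) (s : F V),
      cm b h (cmU f V s) = cmU f' W (cm a h s)) :
  open_iso a -> open_iso b -> open_iso (coker_map comm).
Proof.
move=> ia ib V; have hV := open_restr_descend_sub (@subset_refl _ V).
have E s : cmU (open_restr_descend (coker_map comm)) V (piz _ s) =
    piz _ (cmU (open_restr_descend b) V s) := quot_mapE _ s.
split=> [s|t].
  rewrite -[s]pizP; move: (repr s) => {}s.
  rewrite E => /piz_eq0P/imzP[u eu]; apply/piz_eq0P/imzP.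
  have [u0 eu0] := (ia V).2 u; exists u0.
  apply/eqP; rewrite -subr_eq0; apply/eqP; apply: (ib V).1.
  rewrite raddfB -eu -eu0; apply/eqP; rewrite subr_eq0; apply/eqP.
  exact: comm.
have [s es] := (ib V).2 (repr t); exists (piz _ s).
by rewrite E es pizP.
Qed.

Lemma open_iso_godA (F : presheaf X) (G : presheaf (subsp U)) (a : comorph j F G) p :
  open_iso a -> open_iso (godA_map a p).
Proof.
move=> ia; apply: open_iso_disc; elim: p => [//|p IHp].
by apply: open_iso_sheafify; apply: open_iso_coker => //; apply: open_iso_disc.
Qed.

Lemma open_iso_unit (F : presheaf X) : open_iso (open_restr_unit U F).
Proof.
move=> V.
have E s : cmU (open_restr_descend (open_restr_unit U F)) V s = s.
  exact: (@res_id X F (subsp_img V) _ s).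
by split=> [s|t]; [rewrite E | exists t].
Qed.

Lemma open_iso_coh (K : pcomplex X) (L : pcomplex (subsp U)) (a : pcomap j K L) q :
  (forall n, open_iso (a n)) -> open_iso (coh_sheaf_map a q).
Proof.
move=> ia; apply: open_iso_sheafify => V.
have E (s : cocycle (sections K (subsp_img V)) q) :
    cmU (open_restr_descend (coh_presheaf_map a q)) V (piz _ s) =
    piz _ (cocycle_map (sections_map a (open_restr_descend_sub (@subset_refl _ V))) q s)
  := quot_mapE _ s.
split=> [s|t].
  rewrite -[s]pizP; move: (repr s) => {}s.
  rewrite E => /piz_eq0P h; apply/piz_eq0P.
  case: q s h {E} => [|q] s.
    by move=> /eqP h; apply/eqP; apply: (ia 0%N V).1.
  move=> /imzP[u eu]; apply/imzP; have [u0 eu0] := (ia q V).2 u; exists u0.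
  apply/eqP; rewrite -subr_eq0; apply/eqP; apply: (ia q.+1 V).1.
  rewrite raddfB; apply/eqP; rewrite subr_eq0; apply/eqP.
  by rewrite -[RHS]eu -eu0; apply: pcm_d.
have [s es] := (ia q V).2 (val (repr t)).
have hs : s \in kerz (cdiff (sections K (subsp_img V)) q).
  rewrite inE; apply/eqP; apply: (ia q.+1 V).1; rewrite [LHS]pcm_d.
  by rewrite [cm _ _ _]es; apply/eqP; apply: (valP (repr t)).
exists (piz _ (exist _ s hs : cocycle (sections K (subsp_img V)) q)).
by rewrite E -[RHS]pizP; congr (piz _ _); apply: val_inj.
Qed.
End OpenIso.

Section HigherImageIso.
Variables (M N : topologicalType) (f : continuousType M N) (N' : opens N).

Lemma opens_eq (X : topologicalType) (V W : opens X) : V `<=` W -> W `<=` V -> V = W.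
Proof.
move=> h h'; case: V h h' => V oV h h'; case: W h h' => W oW /= h h'.
have e : V = W by apply/seteqP.
by case: W / e oW {h h'} => oW; congr Opens; apply: Prop_irrelevance.
Qed.

Lemma open_iso_direct_image (F : presheaf M) (G : presheaf (subsp (opensV f N')))
    (a : comorph (subsp_incl (opensV f N')) F G) :
  open_iso a -> open_iso (direct_image_comorph (@restrict_mapE M N f N') a).
Proof.
move=> ia V.
have e : opensV f (subsp_img V) = subsp_img (opensV (restrict_map f N') V).
  apply: opens_eq => [x [y Vy e]|_ [x Vx <-]]; last by exists (restrict_map f N' x).
  have hx : x \in (opensV f N' : set M).
    by apply: mem_set; rewrite /= /preimage /= -e; apply: (set_valP y).
  exists (exist _ x hx) => //=.
  have E : restrict_map f N' (exist _ x hx) = y by apply: val_inj; apply: (esym e).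
  suff: oset V (restrict_map f N' (exist _ x hx)) by [].
  by rewrite E.
have K (W : opens M) (h : opensV (restrict_map f N') V `<=` subsp_incl _ @^-1` W) :
    W = subsp_img (opensV (restrict_map f N') V) -> isoz (cm a h).
  by move=> eW; move: h; rewrite eW => h; apply: open_iso_bij.
exact: K.
Qed.

Variables (S : presheaf M) (q : nat).

Lemma higher_image_iso_bijective (V : opens (subsp N')) :
  bijective (cmU (higher_image_iso f N' S q) V).
Proof.
apply: isoz_bijective; apply: open_iso_coh => n.
by apply: open_iso_direct_image; apply: open_iso_godA; apply: open_iso_unit.
Qed.
End HigherImageIso.

(* The graded group (C^n) lives inside one group [fgrp], with
   C^n = [filt 0 n] and F^p(C^n) = [filt p n]. *)
Record filtered_complex := Filtered {
  fgrp : zmodType;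
  fdiff : {additive fgrp -> fgrp};
  filt : nat -> nat -> zmodClosed fgrp;
  fdiffK : forall a, fdiff (fdiff a) = 0;
  filt_dec : forall p n a, a \in filt p.+1 n -> a \in filt p n;
  filt_diff : forall p n a, a \in filt p n -> fdiff a \in filt p n.+1 }.

Section SpectralSequence.
Variable C : filtered_complex.
Local Notation D := (fdiff C).
Local Notation F := (filt C).

(* Z_r^p = {a in F^p C^n | D a in F^(p+r) C^(n+1)} *)
Definition ssZ (r p n : nat) : {pred fgrp C} :=
  [pred a | (a \in F p n) && (D a \in F (p + r)%N n.+1)].
Fact ssZ_closed r p n : zmod_closed (ssZ r p n).
Proof.
split=> [|a b]; rewrite !inE ?raddf0 ?rpred0 //.
by move=> /andP[a1 a2] /andP[b1 b2]; rewrite raddfB !rpredB.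
Qed.
HB.instance Definition _ r p n :=
  GRing.isZmodClosed.Build (fgrp C) (ssZ r p n) (ssZ_closed r p n).

Definition filt_pred (p n : nat) : zmodClosed (fgrp C) :=
  if n is m.+1 then F p m else (@zeroz (fgrp C) : zmodClosed (fgrp C)).

(* Z_(r-1)^(p+1) + (F^p C^n /\ D (F^(p-r+1) C^(n-1))), for r > 0; as F^i = F^0 for
   i < 0, the truncated subtraction is the right one. *)
Definition ssB_prop (r p n : nat) (a : fgrp C) : Prop :=
  exists b c, [/\ b \in ssZ r.-1 p.+1 n, c \in filt_pred (p - r.-1) n,
                  D c \in F p n & a = b + D c].
Definition ssB (r p n : nat) : {pred fgrp C} := fun a => `[< ssB_prop r p n a >].
Lemma ssBP r p n a : reflect (ssB_prop r p n a) (a \in ssB r p n).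
Proof. exact: asboolP. Qed.
Fact ssB_closed r p n : zmod_closed (ssB r p n).
Proof.
split=> [|a a' /ssBP[b [c [hb hc hD ->]]] /ssBP[b' [c' [hb' hc' hD' ->]]]];
    apply/ssBP.
  by exists 0, 0; rewrite raddf0 !rpred0 addr0.
by exists (b - b'), (c - c'); rewrite raddfB !rpredB // opprD addrACA.
Qed.
HB.instance Definition _ r p n :=
  GRing.isZmodClosed.Build (fgrp C) (ssB r p n) (ssB_closed r p n).

(* E_r^{p,n-p}, indexed by the filtration degree p and the total degree n *)
Definition ssE (r p n : nat) : zmodType :=
  Quotient.quot (preimz (val : subz (ssZ r p n) -> fgrp C) (ssB r p n)).

Definition ssclass (r p n : nat) : {additive subz (ssZ r p n) -> ssE r p n} := piz _.

Fact ssd_Z r p n a : a \in ssZ r p n -> D a \in ssZ r (p + r) n.+1.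
Proof. by rewrite !inE fdiffK rpred0 => /andP[_ ->]. Qed.
Fact ssd_B r p n (a : subz (ssZ r p n)) :
  a \in preimz (val : subz (ssZ r p n) -> fgrp C) (ssB r p n) ->
  subz_map (@ssd_Z r p n) a \in
    preimz (val : subz (ssZ r (p + r) n.+1) -> fgrp C) (ssB r (p + r) n.+1).
Proof.
move=> /ssBP[b [c [hb _ _ e]]]; apply/ssBP; exists 0, b.
have eD : D (val a) = D b by rewrite e raddfD fdiffK addr0.
split; first exact: rpred0.
- move: hb => /andP[hb _]; case: r {a e eD} => [|r] /= in hb *.
    by rewrite subn0 addn0; apply: filt_dec.
  by rewrite addnS subSn ?leq_addl // addnK.
- have : val a \in ssZ r p n by apply: (valP a).
  by case/andP => _; rewrite eD.
- by rewrite add0r -eD.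
Qed.
(* d_r : E_r^{p,q} -> E_r^{p+r,q-r+1}, induced by D *)
Definition ssd (r p n : nat) : {additive ssE r p n -> ssE r (p + r) n.+1} :=
  quot_map (@ssd_B r p n).
End SpectralSequence.
Arguments ssZ : clear implicits.
Arguments ssclass {C r p n}.

Record double_complex := DoubleComplex {
  dgrp :> nat -> nat -> zmodType;
  del : forall p q, {additive dgrp p q -> dgrp p.+1 q};
  delbar : forall p q, {additive dgrp p q -> dgrp p q.+1};
  delK : forall p q x, del p.+1 q (del p q x) = 0;
  delbarK : forall p q x, delbar p q.+1 (delbar p q x) = 0;
  delC : forall p q x, del p q.+1 (delbar p q x) = delbar p.+1 q (del p q x) }.

Section Total.
Variable A : double_complex.

(* The product of all the A^{p,q}; A^n is the subgroup of the families supported on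
   p + q = n *)
Definition tgrp : zmodType :=
  dprod (fun p => dprod (fun q => A p q) : zmodType).

Definition signed (V : zmodType) (n : nat) (x : V) : V := if odd n then - x else x.

(* The component of D a in A^{p,q}, for D = (-1)^(p+q) del + delbar *)
Definition tdiff_fun (a : tgrp) : tgrp := fun p q =>
  (match p return A p q with
   | 0 => 0
   | p'.+1 => signed (p' + q) (del A p' q (a p' q))
   end) +
  (match q return A p q with
   | 0 => 0
   | q'.+1 => delbar A p q' (a p q')
   end).

Lemma tgrp_eq (a b : tgrp) : (forall p q, a p q = b p q) -> a = b.
Proof.
move=> e; apply: functional_extensionality_dep => p.
by apply: functional_extensionality_dep => q; apply: e.
Qed.

Fact tdiff_additive : zmod_morphism tdiff_fun.
Proof.
move=> a b; apply: tgrp_eq => p q.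
rewrite [RHS](_ : _ = tdiff_fun a p q - tdiff_fun b p q) // /tdiff_fun.
rewrite opprD addrACA; congr (_ + _).
  case: p => [|p]; first by rewrite subr0.
  rewrite (_ : (a - b) p q = a p q - b p q) // raddfB /signed.
  by case: odd; rewrite // opprD.
case: q => [|q]; first by rewrite subr0.
by rewrite (_ : (a - b) p q = a p q - b p q) // raddfB.
Qed.
HB.instance Definition _ := GRing.isZmodMorphism.Build tgrp tgrp tdiff_fun tdiff_additive.

Fact tdiffK a : tdiff_fun (tdiff_fun a) = 0.
Proof.
apply: tgrp_eq => p q; rewrite [RHS](_ : _ = 0) // /tdiff_fun.
have sD (V W : zmodType) (h : {additive V -> W}) n x : h (signed n x) = signed n (h x).
  by rewrite /signed; case: odd; rewrite // raddfN.
case: p => [|p]; case: q => [|q].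
- by rewrite addr0.
- by rewrite !add0r; case: q => [|q]; rewrite ?delbarK ?raddf0.
- rewrite !addr0; case: p => [|p]; first by rewrite raddf0 /signed; case: odd; rewrite ?oppr0.
  by rewrite sD delK /signed; case: odd; case: odd; rewrite ?oppr0.
have e1 : delbar A p.+1 q (match q return A p.+1 q with
    0 => 0 | q'.+1 => delbar A p.+1 q' (a p.+1 q') end) = 0.
  by case: q => [|q]; rewrite ?delbarK ?raddf0.
have e2 : del A p q.+1 (match p return A p q.+1 with
    0 => 0 | p'.+1 => signed (p' + q.+1) (del A p' q.+1 (a p' q.+1)) end) = 0.
  case: p {e1} => [|p]; rewrite ?raddf0 // sD delK /signed.
  by case: odd; rewrite ?oppr0.
rewrite !raddfD e1 e2 addr0 add0r delC sD /signed addnS /=.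
by case: odd; rewrite /= ?addNr ?subrr.
Qed.

(* F^p(A^n) = sum of the A^{i,j} with i + j = n and i >= p *)
Definition tfilt_prop (p n : nat) (a : tgrp) : Prop :=
  forall i j, ~~ ((i + j == n)%N && (p <= i)%N) -> a i j = 0.
Definition tfilt (p n : nat) : {pred tgrp} := fun a => `[< tfilt_prop p n a >].
Lemma tfiltP p n a : reflect (tfilt_prop p n a) (a \in tfilt p n).
Proof. exact: asboolP. Qed.
Fact tfilt_closed p n : zmod_closed (tfilt p n).
Proof.
split=> [|a b /tfiltP ha /tfiltP hb]; apply/tfiltP => i j h //.
by rewrite (_ : (a - b) i j = a i j - b i j) // ha // hb // subrr.
Qed.
HB.instance Definition _ p n :=
  GRing.isZmodClosed.Build tgrp (tfilt p n) (tfilt_closed p n).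

Fact tfilt_dec p n a : a \in tfilt p.+1 n -> a \in tfilt p n.
Proof.
move=> /tfiltP h; apply/tfiltP => i j k; apply: h; apply: contra k.
by case/andP=> -> /ltnW.
Qed.
Fact tfilt_diff p n a : a \in tfilt p n -> tdiff_fun a \in tfilt p n.+1.
Proof.
move=> /tfiltP h; apply/tfiltP => i j k; rewrite /tdiff_fun.
rewrite (_ : (match i with 0 => _ | i'.+1 => _ end) = 0) ?add0r.
  case: j k => [//|j] k; rewrite h ?raddf0 //; apply: contra k.
  by rewrite addnS eqSS.
case: i k => [//|i] k; rewrite h ?raddf0 /signed ?oppr0 ?if_same //; apply: contra k.
by rewrite addSn eqSS => /andP[-> /leqW].
Qed.

Definition total_complex : filtered_complex :=
  @Filtered tgrp tdiff_fun (fun p n => tfilt p n) tdiffK tfilt_dec tfilt_diff.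
End Total.

Section GodComp0.
Variables (X : topologicalType).
Definition comp0 (F G H : presheaf X) (a : psh_morph F G) (b : psh_morph G H) : Prop :=
  forall (U : opens X) (s : F U), cmU b U (cmU a U s) = 0.

Lemma disc_comp0 F G H (a : psh_morph F G) (b : psh_morph G H) :
  comp0 a b -> comp0 (disc_map a) (disc_map b).
Proof.
move=> h U s; apply: disc_eq => x Ux.
rewrite /cmU /= /disc_map_sec; move: (s _ _); elim/stalk_ind => V Vx t.
rewrite (stalk_mapE a (@subset_refl _ V) Vx Vx).
rewrite (stalk_mapE b (@subset_refl _ V) Vx Vx).
by rewrite [cm b _ _]h raddf0.
Qed.

Lemma godQ_comp0 F G H (a : psh_morph F G) (b : psh_morph G H) :
  comp0 a b -> comp0 (godQ_map a) (godQ_map b).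
Proof.
move=> h U s; apply: val_inj; apply: disc_comp0; move: U {s} => _ U s.
rewrite -[s]pizP; have [t ->] : exists t, repr s = t by exists (repr s).
have ea : cmU (coker_map (disc_unit_nat a)) U (piz _ t) =
    piz _ (cmU (disc_map a) U t) := quot_mapE _ _.
have eb : cmU (coker_map (disc_unit_nat b)) U (piz _ (cmU (disc_map a) U t)) =
    piz _ (cmU (disc_map b) U (cmU (disc_map a) U t)) := quot_mapE _ _.
by rewrite ea eb (disc_comp0 h) raddf0.
Qed.

Lemma godA_comp0 F G H (a : psh_morph F G) (b : psh_morph G H) p :
  comp0 a b -> comp0 (godA_map a p) (godA_map b p).
Proof.
move=> h; apply: disc_comp0; elim: p => [//|p IHp]; exact: godQ_comp0.
Qed.
End GodComp0.

Section Leray.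
Variables (M N : topologicalType) (f : continuousType M N) (S : presheaf M).
Local Notation K := (leray_complex f S).
Local Notation T := (opensT N).

Definition leray_grp (p q : nat) : zmodType := godA p (direct_image f (godA q S)) T.
Definition leray_del (p q : nat) : {additive leray_grp p q -> leray_grp p.+1 q} :=
  cmU (god_diff p (direct_image f (godA q S))) T.
Definition leray_delbar (p q : nat) : {additive leray_grp p q -> leray_grp p q.+1} :=
  cmU (godA_map (direct_image_morph f (god_diff q S)) p) T.
Fact leray_delK p q x : leray_del p.+1 q (leray_del p q x) = 0.
Proof. exact: god_diffK. Qed.
Fact leray_delbarK p q x : leray_delbar p q.+1 (leray_delbar p q x) = 0.
Proof. by apply: godA_comp0 => U s; apply: (@pdK _ K). Qed.
Fact leray_delC p q x :
  leray_del p q.+1 (leray_delbar p q x) = leray_delbar p.+1 q (leray_del p q x).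
Proof. by rewrite /leray_delbar {2}/cmU god_diff_nat. Qed.

Definition leray_double : double_complex :=
  DoubleComplex leray_delK leray_delbarK leray_delC.

Definition lerayE (r p n : nat) : zmodType := ssE (total_complex leray_double) r p n.
Definition leray_d (r p n : nat) : {additive lerayE r p n -> lerayE r (p + r) n.+1} :=
  ssd (total_complex leray_double) r p n.

(* The correspondence E_2^{p,q} ~ H^p_del (H^q_delbar (A^{*,*})) ~ H^p(N, R^q f_* S):
   as A^p is exact, ker (delbar : A^{p,q} -> A^{p,q+1}) is Gamma(N, A^p(Z^q)) for the
   sheaf Z^q of cocycles of f_* A^q(S), and H^q_delbar(A^{p,*}) = Gamma(N, A^p(R^q f_* S))
   through the projection Z^q -> R^q f_* S. Thus the class of a in Z_2^{p,q}, with leading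
   component a_{p,q} = z in Gamma(N, A^p(Z^q)), goes to the class of the image of z. *)
Definition leray_E2_rel (p q n : nat) (x : lerayE 2 p n)
    (y : sheaf_coh p (higher_image f S q)) : Prop :=
  exists (a : subz (ssZ (total_complex leray_double) 2 p n))
    (z : godA p (cocycle_presheaf K q) T)
    (c : cocycle (sections (godement (higher_image f S q)) T) p),
  [/\ ssclass a = x,
      cmU (godA_map (cocycle_incl K q) p) T z = val a p q,
      cmU (godA_map (cocycle_proj K q) p) T z = val c &
      coclass c = y].

Definition leray_E2_iso (p q n : nat)
    (iota : {additive lerayE 2 p n -> sheaf_coh p (higher_image f S q)}) : Prop :=
  bijective iota /\ forall x y, leray_E2_rel x y <-> iota x = y.

(* d2 is the differential d_2 : E_2^{p,q} -> E_2^{p+2,q-1} (q > 0), through the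
   isomorphisms above; the total degree of E_2^{p+2,q-1} is p + q + 1. *)
Definition is_leray_d2 (p q : nat)
    (d2 : {additive sheaf_coh p (higher_image f S q) ->
                    sheaf_coh (p + 2) (higher_image f S (q - 1))}) : Prop :=
  exists (iota : {additive lerayE 2 p (p + q) -> sheaf_coh p (higher_image f S q)})
         (iota' : {additive lerayE 2 (p + 2) (p + q).+1 ->
                            sheaf_coh (p + 2) (higher_image f S (q - 1))}),
  [/\ leray_E2_iso iota, leray_E2_iso iota' &
      forall x, d2 (iota x) = iota' (leray_d 2 p (p + q) x)].
End Leray.

(* Main.v *)
Require Import Defs.
From HB Require Import structures.
From mathcomp Require Import all_boot all_order all_algebra.
From mathcomp Require Import all_classical topology.

Set Implicit Arguments.
Unset Strict Implicit.
Unset Printing Implicit Defensive.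

Import GRing.Theory.
Local Open Scope classical_set_scope.
Local Open Scope ring_scope.

(** The Leray double complex is functorial under restriction to [N'], so the induced map
    of spectral sequences commutes with [d_2] on the nose; the content lies in identifying
    the second terms with the cohomology of the sheaves [R^q f_* S], compatibly with
    restriction.

    The differentials are obtained by transport of structure: [d2] is [d_2] conjugated by
    the isomorphisms of [leray_E2_isoP]. These are graphs of the relation
    [leray_E2_rel] (take the leading component of a representative and project it to the
    cohomology sheaf). Restriction maps a triple witnessing this relation over [N] to
    a triple witnessing it over [N'] ([leray_E2_rel_res]), which is exactly the
    commutation of the isomorphisms with restriction; the square of the theorem follows.

    That the relation is the graph of an isomorphism splits into algebra and exactness.
    The algebra ([E2_rel_iso]) holds for any double complex in which the kernels of
    [delbar] in one row are the terms of a complex [Z] surjecting onto a complex [H] with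
    kernel the image of [delbar]. To apply it with [Z^p = Gamma(N, A^p(Z^q))] and
    [H^p = Gamma(N, A^p(R^q f_* S))], one needs that [Gamma(N, A^p(-))] turns
    injectivity, surjectivity and exactness on stalks into the same properties of groups
    ([godA_inj], [godA_surj], [godA_exact]). Sections of [A^0] are products of stalks, and the stalks of [A^0(F) / F]
    are natural direct summands of those of [A^0(F)], split off by evaluation at the
    point; so each property passes from [F] to [A^0(F) / F], and from there to every
    [A^p(F)]. *)

(** * Filtered complexes and their spectral sequences *)

(** The isomorphism on the second term is only described as a relation between
    classes; a relation that is a subgroup of the product, total and single-valued
    is the graph of a homomorphism. *)
Lemma additive_graph (V W : zmodType) (R : V -> W -> Prop) :
    (forall x x' y y', R x y -> R x' y' -> R (x - x') (y - y')) ->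
    (forall x, exists y, R x y) -> (forall y, R 0 y -> y = 0) ->
  exists f : {additive V -> W}, forall x y, R x y <-> f x = y.
Proof.
move=> RB Rtot R0; have [f Rf] := choice Rtot.
have RE x y : R x y -> f x = y.
  move=> Rxy; apply/eqP; rewrite -subr_eq0; apply/eqP/R0.
  by rewrite -[0](subrr x); apply: RB.
have fB : zmod_morphism f by move=> x y; apply/RE/RB.
pose F : {additive V -> W} := HB.pack f (GRing.isZmodMorphism.Build V W f fB).
by exists F => x y; split=> [/RE|<-] //; apply: Rf.
Qed.

Section FilteredMap.
Variables (C C' : filtered_complex) (phi : {additive fgrp C -> fgrp C'}).
Hypothesis phi_diff : forall a, phi (fdiff C a) = fdiff C' (phi a).
Hypothesis phi_filt : forall p n a, a \in filt C p n -> phi a \in filt C' p n.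

Lemma filtered_map_Z r p n a : a \in ssZ C r p n -> phi a \in ssZ C' r p n.
Proof.
by rewrite !inE => /andP[a1 a2]; rewrite -phi_diff !phi_filt.
Qed.

Lemma filtered_map_B r p n (a : subz (ssZ C r p n)) :
  a \in preimz (val : subz (ssZ C r p n) -> fgrp C) (ssB r p n) ->
  subz_map (@filtered_map_Z r p n) a \in
    preimz (val : subz (ssZ C' r p n) -> fgrp C') (ssB r p n).
Proof.
move=> /ssBP[b [c [hb hc hD e]]]; apply/ssBP; exists (phi b), (phi c); split.
- exact: filtered_map_Z.
- by case: n hc {a hb hD e} => [/eqP->|n]; [rewrite raddf0 rpred0|apply: phi_filt].
- by rewrite -phi_diff phi_filt.
- by rewrite -phi_diff -raddfD -e.
Qed.

Definition ssE_map r p n : {additive ssE C r p n -> ssE C' r p n} :=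
  quot_map (@filtered_map_B r p n).

Lemma ssE_map_class r p n a :
  ssE_map r p n (ssclass a) = ssclass (subz_map (@filtered_map_Z r p n) a).
Proof. exact: quot_mapE. Qed.

Lemma ssE_map_d r p n x :
  ssE_map r (p + r) n.+1 (ssd C r p n x) = ssd C' r p n (ssE_map r p n x).
Proof.
rewrite -[x]pizP; move: (repr x) => {}x.
rewrite [ssd _ _ _ _ _]quot_mapE [LHS]quot_mapE [ssE_map _ _ _ _]quot_mapE.
by rewrite [RHS]quot_mapE; congr (piz _ _); apply: val_inj; apply: phi_diff.
Qed.
End FilteredMap.

Section TotalMap.
Variables (A A' : double_complex) (m : forall p q, {additive A p q -> A' p q}).
Hypothesis m_del : forall p q x, m p.+1 q (del A p q x) = del A' p q (m p q x).
Hypothesis m_delbar : forall p q x, m p q.+1 (delbar A p q x) = delbar A' p q (m p q x).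

Definition total_map (a : tgrp A) : tgrp A' := fun p q => m p q (a p q).
Fact total_map_additive : zmod_morphism total_map.
Proof. by move=> a b; apply: tgrp_eq => p q; apply: raddfB. Qed.
HB.instance Definition _ :=
  GRing.isZmodMorphism.Build (tgrp A) (tgrp A') total_map total_map_additive.

Lemma total_map_diff a :
  total_map (fdiff (total_complex A) a) = fdiff (total_complex A') (total_map a).
Proof.
apply: tgrp_eq => p q; rewrite /total_map /= /tdiff_fun raddfD.
congr (_ + _); last by case: q => [|q]; rewrite ?raddf0 ?m_delbar.
case: p => [|p]; first by rewrite raddf0.
by rewrite /signed; case: odd; rewrite ?raddfN m_del.
Qed.

Lemma total_map_filt p n a :
  a \in filt (total_complex A) p n -> total_map a \in filt (total_complex A') p n.
Proof.
by move=> /tfiltP h; apply/tfiltP => i j k; rewrite /total_map h // raddf0.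
Qed.
End TotalMap.

(** * The second term of a double complex *)

Definition column (A : double_complex) (p : nat) : cochain :=
  Cochain (fun q x => @delbarK A p q x).

Lemma cobound0P (K : cochain) (x : K 0) : reflect (x = 0) (x \in cobound K 0).
Proof. exact: eqP. Qed.

(** The setting is [E_2^(p,q) = H^p_del (H^q_delbar A)] for a fixed row [q]: the complex
    [Z] stands for the kernels of [delbar] in bidegrees [(p, q)], embedded by [i], and [H]
    for the quotients by the image of [delbar], with [pr] the projection. *)
Section DoubleE2.
Variables (A : double_complex) (q : nat).
Local Notation C := (total_complex A).
Local Notation D := (fdiff C).

Definition single p j (x : A p j) : tgrp A :=
  dfwith (T := fun p => dprod (fun j => A p j)) (fun=> 0) p
    (dfwith (T := fun j => A p j) (fun=> 0) j x).

Lemma single_same p j (x : A p j) : single x p j = x.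
Proof. by rewrite /single !dfwithin. Qed.

Lemma single_other p j (x : A p j) i k :
  ~~ ((i == p) && (k == j)) -> single x i k = 0.
Proof.
rewrite /single; have [->|ip] /= := eqVneq i p; last by rewrite dfwithout 1?eq_sym.
by rewrite dfwithin => kj; rewrite dfwithout 1?eq_sym.
Qed.

Lemma single_filt p j (x : A p j) n : (p + j = n)%N -> single x \in filt C p n.
Proof.
move=> <-; apply/tfiltP => i k h; apply: single_other; apply: contra h.
by case/andP=> /eqP-> /eqP->; rewrite eqxx leqnn.
Qed.

(** The only component of degree [n] that distinguishes [F^p] from [F^(p+1)] is the one
    at [(p, n - p)]. *)
Lemma filtS p j n (a : tgrp A) : (p + j = n)%N ->
  a \in filt C p n -> a p j = 0 -> a \in filt C p.+1 n.
Proof.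
move=> <- /tfiltP h e; apply/tfiltP => i k.
have [/andP[/eqP-> /eqP->] //|ne] := boolP ((i == p) && (k == j)).
move=> h'; apply: h; apply: contra h' => /andP[ik]; rewrite leq_eqVlt ik.
case/orP => [/eqP ip|//]; rewrite -ip eqn_add2l in ik.
by rewrite -ip eqxx ik in ne.
Qed.

Lemma filtS_eq0 p j n (a : tgrp A) : a \in filt C p.+1 n -> a p j = 0.
Proof. by move/tfiltP; apply; rewrite ltnn andbF. Qed.

Lemma diff_lead p j n (a : tgrp A) : a \in filt C p n ->
  D a p j.+1 = delbar A p j (a p j).
Proof.
move=> /tfiltP h; rewrite /= /tdiff_fun.
case: p h => [|p] h; first by rewrite add0r.
by rewrite (h p) ?ltnn ?andbF // raddf0 /signed oppr0 if_same add0r.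
Qed.

Lemma diff_lead_cobound p j n (a : tgrp A) : a \in filt C p n ->
  D a p j \in cobound (column A p) j.
Proof.
move=> aF; case: j => [|j]; last first.
  by rewrite (diff_lead _ aF); apply/imzP; exists (a p j).
move: aF => /tfiltP h; rewrite inE /= /tdiff_fun addr0.
case: p h => [//|p] h.
by rewrite (h p) ?ltnn ?andbF // raddf0 /signed oppr0 if_same.
Qed.

Lemma diffS_cobound p j (a : tgrp A) :
  D a p.+1 j - signed (p + j) (del A p j (a p j)) \in cobound (column A p.+1) j.
Proof.
rewrite /= /tdiff_fun addrC addKr; case: j => [|j]; first by rewrite inE.
by apply/imzP; exists (a p.+1 j).
Qed.

Lemma signedK (V : zmodType) n : involutive (@signed V n).
Proof. by move=> x; rewrite /signed; case: odd; rewrite ?opprK. Qed.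

Lemma raddf_signed (V W : zmodType) (h : {additive V -> W}) n x :
  h (signed n x) = signed n (h x).
Proof. by rewrite /signed; case: odd; rewrite ?raddfN. Qed.

Lemma rpred_signed (V : zmodType) (T : zmodClosed V) n x :
  (signed n x \in T) = (x \in T).
Proof. by rewrite /signed; case: odd; rewrite ?rpredN. Qed.

Lemma diff_single p j (x : A p j) :
  D (single x) p.+1 j = signed (p + j) (del A p j x).
Proof.
rewrite /= /tdiff_fun single_same; case: j x => [|j] x; first by rewrite addr0.
by rewrite single_other ?raddf0 ?addr0 // eqn_leq ltnn.
Qed.

(** For [j = 0] both [e] and [b] vanish, [0] being the only element of degree [p - 1]
    and filtration [p]. *)
Lemma cobound_lift p j e : e \in cobound (column A p) j ->
  exists2 b, b \in filt_pred C p (p + j) & D b p j = e.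
Proof.
case: j e => [|j] e; first by rewrite inE => /eqP->; exists 0; rewrite ?rpred0 ?raddf0.
case/imzP => u <-; have uF : single u \in filt C p (p + j) by apply: single_filt.
by exists (single u); rewrite ?addnS // (diff_lead _ uF) single_same.
Qed.

Variables (Z H : cochain) (i : forall p, {additive Z p -> A p q}) (pr : chain_map Z H).
Hypothesis i_del : forall p z, i p.+1 (cdiff Z p z) = del A p q (i p z).
Hypothesis i_im : forall p a, delbar A p q a = 0 <-> exists z, i p z = a.
Hypothesis pr_surj : forall p h, exists z, pr p z = h.
Hypothesis pr_ker : forall p z, pr p z = 0 <-> i p z \in cobound (column A p) q.

(** The cocycles of bidegree [(p, q)] that die in [H^p] of the complex [H] are the
    leading terms of boundaries [D c] with [c] of filtration [p - 1]. In one direction,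
    [c = b + w] up to the sign of [w], where [del w] is the coboundary downstairs, lifted through the
    surjection [pr], and where [delbar b] corrects the error of that lift, which lies
    in the kernel of [pr]. Conversely [D c] having filtration [p] forces the component
    of [c] at [(p - 1, q)] to be a cocycle of [delbar]. For [p = 0] the truncated
    [p - 1] is [0] and there is no [w]. *)
Lemma cobound_E2P p z : pr p z \in cobound H p <->
  exists c, [/\ c \in filt_pred C (p - 1) (p + q), D c \in filt C p (p + q) &
                D c p q = i p z].
Proof.
split.
  case: p z => [|p] z.
    rewrite inE => /eqP/pr_ker/cobound_lift[b bF e]; exists b; split=> //.
    by case: {e}(q) bF => [/eqP->|q'] //; rewrite ?raddf0 ?rpred0 //; apply: tfilt_diff.
  case/imzP => v; have [w <-] := pr_surj v.
  rewrite -chm_diff => /eqP; rewrite eq_sym -subr_eq0 -raddfB => /eqP.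
  move=> /pr_ker/cobound_lift[b bF e].
  have iw : single (i p w) \in filt C p (p + q) by apply: single_filt.
  exists (b + signed (p + q) (single (i p w))); rewrite subn1; split.
  - apply: rpredD; first exact: tfilt_dec.
    by rewrite [_ \in _]rpred_signed.
  - rewrite raddfD rpredD //; first exact: tfilt_diff.
    rewrite raddf_signed rpred_signed; apply: (@filtS _ q.+1); first by rewrite addnS.
      exact: tfilt_diff.
    by rewrite (diff_lead _ iw) single_same; apply/i_im; exists w.
  - rewrite raddfD raddf_signed.
    transitivity (D b p.+1 q + signed (p + q) (D (single (i p w)) p.+1 q)).
      by rewrite /signed; case: odd.
    by rewrite diff_single signedK e raddfB i_del subrK.
case=> c []; case: p z => [|p] z cF DF e.
  rewrite inE; apply/eqP/pr_ker; rewrite -e.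
  case: {e DF}(q) cF => [/eqP->|q'] //; rewrite ?raddf0 ?rpred0 // => cF.
  exact: (diff_lead_cobound _ cF).
rewrite subn1 in cF; have := diff_lead q cF.
rewrite (filtS_eq0 _ DF) => /esym/i_im[w ew].
have := diffS_cobound p q c; rewrite e -ew -i_del -raddf_signed -raddfB.
move/pr_ker/eqP; rewrite raddfB subr_eq0 => /eqP->.
by rewrite raddf_signed rpred_signed chm_diff; apply/imzP; exists (pr p w).
Qed.

(** A class of [E_2] and a class of [H^p(H)] correspond when the leading term of a
    representative of the former projects to a representative of the latter. *)
Definition E2_rel p n (x : ssE C 2 p n) (y : cohomology H p) : Prop :=
  exists (a : subz (ssZ C 2 p n)) (z : Z p) (c : cocycle H p),
  [/\ ssclass a = x, i p z = val a p q, pr p z = val c & coclass c = y].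

Lemma E2_relB p n x x' y y' :
  @E2_rel p n x y -> E2_rel x' y' -> E2_rel (x - x') (y - y').
Proof.
move=> [a [z [c [<- ez ec <-]]]] [a' [z' [c' [<- ez' ec' <-]]]].
by exists (a - a'), (z - z'), (c - c'); rewrite !raddfB ez ez' ec ec'.
Qed.

(** For [a] in [Z_2], the component of [D a] at [(p, q + 1)] says that the leading term is
    a cocycle of [delbar], and the one at [(p + 1, q)] that its projection is a cocycle
    of [H]. *)
Lemma E2_rel_total p n (x : ssE C 2 p n) : exists y, E2_rel x y.
Proof.
rewrite -[x]pizP; move: (repr x) => {}x; have /andP[xF DxF] := valP x.
rewrite addn2 in DxF; have := diff_lead q xF.
rewrite (filtS_eq0 _ (filt_dec DxF)) => /esym/i_im[z ez].
have cz : pr p z \in kerz (cdiff H p).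
  rewrite inE -chm_diff; apply/eqP/pr_ker; rewrite i_del ez.
  have := diffS_cobound p q (val x).
  by rewrite (filtS_eq0 _ DxF) sub0r rpredN rpred_signed.
pose c : cocycle H p := exist _ (pr p z) cz.
by exists (coclass c), x, z, c.
Qed.

(** A lift [z] of a cocycle of [H] satisfies [del z = delbar u] up to sign, and then
    [z + u] (with the sign on [u]) belongs to [Z_2]. *)
Lemma E2_rel_surj p n y : (p + q = n)%N -> exists x : ssE C 2 p n, E2_rel x y.
Proof.
move=> <-; rewrite -[y]pizP; move: (repr y) => {}y.
have [z ez] := pr_surj (val y).
have : pr p.+1 (cdiff Z p z) = 0.
  by rewrite chm_diff ez; apply/eqP; apply: (valP y).
move=> /pr_ker; rewrite -(rpred_signed _ (p + q)) -rpredN i_del.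
move=> /cobound_lift[b bF e]; pose a := single (i p z) + b.
have iF : single (i p z) \in filt C p (p + q) by apply: single_filt.
have aF : a \in filt C p (p + q) by rewrite rpredD //; apply: tfilt_dec.
have az : a p q = i p z.
  by rewrite [LHS](_ : _ = single (i p z) p q + b p q) // single_same (filtS_eq0 _ bF) addr0.
have aZ : a \in ssZ C 2 p (p + q).
  rewrite inE aF addn2; apply: (@filtS _ q); first by rewrite addSn.
    apply: (@filtS _ q.+1); [by rewrite addnS|exact: tfilt_diff|].
    by rewrite (diff_lead _ aF) az; apply/i_im; exists z.
  rewrite raddfD [LHS](_ : _ = D (single (i p z)) p.+1 q + D b p.+1 q) //.
  by rewrite diff_single e subrr.
pose a2 : subz (ssZ C 2 p (p + q)) := exist _ a aZ.
by exists (ssclass a2), a2, z, y.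
Qed.

(** Injectivity and single-valuedness of the relation both compare the two notions of
    boundary through [cobound_E2P]: modulo [Z_1] of filtration [p + 1], which has no
    component at [(p, q)], an element of [B_2] is such a [D c']. *)
Lemma E2_rel_single p n y : (p + q = n)%N -> @E2_rel p n 0 y -> y = 0.
Proof.
move=> <- [a [z [c [/piz_eq0P/ssBP[b [c' [/andP[bF _] c'F DF ea]]] ez ec <-]]]].
suff: pr p z \in cobound H p by rewrite ec => cH; apply/piz_eq0P.
apply/cobound_E2P; exists c'; split=> //.
by rewrite ez ea [RHS](_ : _ = b p q + D c' p q) // (filtS_eq0 _ bF) add0r.
Qed.

Lemma E2_rel_inj p n x : (p + q = n)%N -> @E2_rel p n x 0 -> x = 0.
Proof.
move=> pqn [a [z [c [<- ez ec /piz_eq0P cH]]]].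
have /cobound_E2P : pr p z \in cobound H p by rewrite ec.
rewrite pqn => -[c' [c'F DF e]]; have /andP[aF DaF] := valP a; rewrite addn2 in DaF.
apply/piz_eq0P/ssBP; exists (val a - D c'), c'; split=> //; last by rewrite subrK.
apply/andP; split; last by rewrite raddfB fdiffK subr0 addn1.
apply: (@filtS _ q) => //; first exact: rpredB.
by rewrite [LHS](_ : _ = val a p q - D c' p q) // e ez subrr.
Qed.

(** The second term of the spectral sequence of the filtration by [p] is the iterated
    cohomology. *)
Lemma E2_rel_iso p n : (p + q = n)%N ->
  exists (iota : {additive ssE C 2 p n -> cohomology H p})
         (kappa : {additive cohomology H p -> ssE C 2 p n}),
    [/\ forall x y, E2_rel x y <-> iota x = y, cancel iota kappa & cancel kappa iota].
Proof.
move=> pqn; have [iota Ri] := additive_graph (@E2_relB p n) (@E2_rel_total p n)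
  (fun y => @E2_rel_single p n y pqn).
have [kappa Rk] : exists f : {additive cohomology H p -> ssE C 2 p n},
    forall y x, E2_rel x y <-> f y = x.
  apply: (@additive_graph _ _ (fun y x => E2_rel x y)).
  - by move=> y y' x x'; apply: E2_relB.
  - by move=> y; apply: E2_rel_surj.
  - by move=> x; apply: E2_rel_inj.
by exists iota, kappa; split=> // [x|y]; [apply/Rk/Ri|apply/Ri/Rk].
Qed.
End DoubleE2.

(** * Functoriality of the Godement resolution *)

Lemma cmU_discE (X : topologicalType) (F G : presheaf X) (k : comorph (cidfun X) F G)
    (U : opens X) (s : disc F U) x (Ux : oset U x) :
  cmU (disc_map k) U s x Ux = stalk_map k (y := x) (s x Ux).
Proof. by congr (stalk_map k (s _ _)); apply: Prop_irrelevance. Qed.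

Section Square.
Variables (X Y : topologicalType) (g : continuousType Y X).

(** Squares commute on sections; one of the four sides of a triangle is taken to be
    [psh_id] below. *)
Definition square (F G : presheaf X) (F' G' : presheaf Y)
    (k : comorph (cidfun X) F G) (k' : comorph (cidfun Y) F' G')
    (a : comorph g F F') (b : comorph g G G') : Prop :=
  forall (U : opens X) (V : opens Y) (h : V `<=` g @^-1` U) (s : F U),
    cm b h (cmU k U s) = cmU k' V (cm a h s).

Variables (F G : presheaf X) (F' G' : presheaf Y).
Variables (k : comorph (cidfun X) F G) (k' : comorph (cidfun Y) F' G').
Variables (a : comorph g F F') (b : comorph g G G').

Lemma square_stalk : square k k' a b -> forall y (u : stalk F (g y)),
  stalk_map b (stalk_map k (y := g y) u) = stalk_map k' (stalk_map a u).
Proof.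
move=> sq y; elim/stalk_ind => U Uy s.
rewrite (stalk_mapE k (@subset_refl _ U) Uy Uy).
rewrite !(stalk_mapE _ (@subset_refl _ (opensV g U)) _ (Uy : oset (opensV g U) y)).
rewrite (stalk_mapE k' (@subset_refl _ (opensV g U)) _ (Uy : oset (opensV g U) y)).
by rewrite [cm b _ _]sq.
Qed.

Lemma square_disc : square k k' a b ->
  square (disc_map k) (disc_map k') (disc_map a) (disc_map b).
Proof.
move=> sq U V h s; apply: disc_eq => y Vy.
rewrite cmU_discE [RHS]/= /disc_map_sec -(square_stalk sq).
by congr stalk_map; apply: cmU_discE.
Qed.

Lemma square_sheafify : square k k' a b ->
  square (sheafify_map k) (sheafify_map k') (sheafify_map a) (sheafify_map b).
Proof.
by move=> sq U V h s; apply: val_inj; apply: (square_disc sq).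
Qed.
End Square.

Section SquareGodement.
Variables (X Y : topologicalType) (g : continuousType Y X).

Lemma square_godQ (F G : presheaf X) (F' G' : presheaf Y)
    (k : comorph (cidfun X) F G) (k' : comorph (cidfun Y) F' G')
    (a : comorph g F F') (b : comorph g G G') :
  square k k' a b -> square (godQ_map k) (godQ_map k') (godQ_map a) (godQ_map b).
Proof.
move=> sq; apply: square_sheafify => U V h s; rewrite -[s]pizP.
rewrite [cmU _ _ _]quot_mapE [LHS]quot_mapE.
rewrite [cm (coker_map _) _ _]quot_mapE [RHS]quot_mapE.
by congr (piz _ _); apply: (square_disc sq).
Qed.

Variables (F G : presheaf X) (F' G' : presheaf Y).
Variables (k : comorph (cidfun X) F G) (k' : comorph (cidfun Y) F' G').
Variables (a : comorph g F F') (b : comorph g G G').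

Lemma square_godA p : square k k' a b ->
  square (godA_map k p) (godA_map k' p) (godA_map a p) (godA_map b p).
Proof.
by move=> sq; apply: square_disc; elim: p => [//|p IHp]; apply: square_godQ.
Qed.
End SquareGodement.

Section Identity.
Variable X : topologicalType.

Definition psh_id (F : presheaf X) : psh_morph F F :=
  @Comorph X X (cidfun X) F F (fun U V h => res F h)
    (fun U U' V V' h h' hU hV s =>
      etrans (res_comp h hV (subset_trans hV h) s) (esym (res_comp hU h' _ s))).

Definition is_id (F : presheaf X) (a : psh_morph F F) : Prop :=
  forall U s, cmU a U s = s.

Lemma psh_id_is_id F : is_id (psh_id F).
Proof. by move=> U s; apply: res_id. Qed.

Lemma is_id_disc F (a : psh_morph F F) : is_id a -> is_id (disc_map a).
Proof.
move=> ida U s; apply: disc_eq => x Ux; rewrite /cmU /= /disc_map_sec /=.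
rewrite (Prop_irrelevance (subset_refl _) Ux); move: (s x Ux).
elim/stalk_ind => V Vx t; rewrite (stalk_mapE a (@subset_refl _ V) Vx Vx).
by rewrite [cm _ _ _]ida.
Qed.

Lemma is_id_godA F (a : psh_morph F F) p : is_id a -> is_id (godA_map a p).
Proof.
move=> ida; apply: is_id_disc; elim: p => [//|p IHp] U s.
apply: val_inj; apply: is_id_disc => {s}U s; rewrite -[s]pizP [LHS]quot_mapE.
by congr (piz _ _); apply: is_id_disc.
Qed.
End Identity.

(** * Exactness of the Godement resolution *)

Section Exactness.
Variable X : topologicalType.

Lemma germ_eq0 (F : presheaf X) x (U : opens X) (Ux : oset U x) (s : F U) :
  germ Ux s = 0 <-> exists (W : opens X) (h : W `<=` U), oset W x /\ res F h s = 0.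
Proof.
split=> [|[W [h [Wx e]]]]; last by rewrite -(germ_res h Ux Wx) e raddf0.
rewrite -(raddf0 (germ Ux)) => /germP[W [h [h' [Wx]]]].
by rewrite raddf0; exists W, h.
Qed.

Lemma germ_sheafify_eq0 (F : presheaf X) x (U : opens X) (Ux : oset U x) (s : F U) :
  germ Ux (cmU (sheafify_unit F) U s) = 0 -> germ Ux s = 0.
Proof.
case/germ_eq0 => W [h [Wx]] /(congr1 (fun t : sheafify F W => val t x Wx)) e.
rewrite -[RHS]e; congr (germ _ s); exact: Prop_irrelevance.
Qed.

Lemma stalk_sheafify_surj (F : presheaf X) x (u : stalk (sheafify F) x) :
  exists (U : opens X) (Ux : oset U x) (s : F U),
    u = germ Ux (cmU (sheafify_unit F) U s).
Proof.
elim/stalk_ind: u => U Ux s.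
have /locally_germsP/(_ x Ux)[V [h [t [Vx e]]]] := valP s.
exists V, Vx, t; rewrite -(germ_res h Ux Vx); congr (germ _ _).
apply: val_inj; apply: disc_eq => y Vy.
by rewrite [LHS]e; congr (germ _ t); apply: Prop_irrelevance.
Qed.

Section Preds.
Variables (E F G : presheaf X) (a : psh_morph E F) (k : psh_morph F G).

Definition stalk_inj : Prop :=
  forall x (u : stalk F x), stalk_map k (y := x) u = 0 -> u = 0.
Definition stalk_surj : Prop :=
  forall x (v : stalk G x), exists u, stalk_map k (y := x) u = v.
Definition stalk_exact : Prop :=
  forall x (u : stalk F x), stalk_map k (y := x) u = 0 ->
    exists v, stalk_map a (y := x) v = u.
End Preds.

(** A section of [disc F] is an arbitrary family of germs, so each property of the stalks
    holds on the sections over every open set. *)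
Section Disc.
Variables (E F G : presheaf X) (a : psh_morph E F) (k : psh_morph F G).

Lemma disc_inj : stalk_inj k ->
  forall (U : opens X) (s : disc F U), cmU (disc_map k) U s = 0 -> s = 0.
Proof.
move=> inj U s e; apply: disc_eq => x Ux; apply: inj.
by rewrite -cmU_discE e.
Qed.

Lemma disc_surj : stalk_surj k ->
  forall (U : opens X) (t : disc G U), exists s, cmU (disc_map k) U s = t.
Proof.
move=> surj U t.
exists (fun x Ux => projT1 (cid (surj x (t x Ux)))); apply: disc_eq => x Ux.
by rewrite cmU_discE (projT2 (cid (surj x (t x Ux)))).
Qed.

Lemma disc_exact : stalk_exact a k ->
  forall (U : opens X) (t : disc F U), cmU (disc_map k) U t = 0 ->
    exists s, cmU (disc_map a) U s = t.
Proof.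
move=> ex U t e.
have et x (Ux : oset U x) : exists v, stalk_map a (y := x) v = t x Ux.
  by apply: ex; rewrite -cmU_discE e.
exists (fun x Ux => projT1 (cid (et x Ux))); apply: disc_eq => x Ux.
by rewrite cmU_discE (projT2 (cid (et x Ux))).
Qed.
End Disc.

Lemma god_proj_unit (F : presheaf X) (U : opens X) (s : F U) :
  cmU (god_proj 0 F) U (cmU (disc_unit F) U s) = 0.
Proof.
rewrite [LHS](_ : _ = cmU (sheafify_unit _) U (cmU (coker_proj (disc_unit F)) U
  (cmU (disc_unit F) U s))) // [cmU (coker_proj _) _ _](_ : _ = 0) ?raddf0 //.
by apply/piz_eq0P; rewrite [res _ _ _]res_id; apply/imzP; exists s.
Qed.

Lemma res_cmU (F G : presheaf X) (k : psh_morph F G) (U V : opens X) (h : V `<=` U) s :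
  res G h (cmU k U s) = cmU k V (res F h s).
Proof. exact: (cm_res k _ _ h h). Qed.

(** Evaluation at [x] retracts [F_x -> (disc F)_x], so the stalk at [x] of
    [disc F / F] is the summand of [(disc F)_x] formed by the germs of families vanishing
    at [x]: they represent every element, and faithfully by [godQ_stalk_eq0]. This
    splitting is natural in [F], which is why [godQ] preserves each exactness
    property. *)
Lemma godQ_stalk_rep (F : presheaf X) x (u : stalk (godQ F) x) :
  exists (U : opens X) (Ux : oset U x) (t : disc F U),
    u = germ Ux (cmU (god_proj 0 F) U t) /\ t x Ux = 0.
Proof.
have [U [Ux [s ->]]] := stalk_sheafify_surj u.
have : exists t, t = repr s by exists (repr s).
case=> t et; move: (pizP s); rewrite -et => {et}<-.
have [V [Vx [r er]]] : exists (V : opens X) (Vx : oset V x) (r : F V), t x Ux = germ Vx r.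
  by elim/stalk_ind: (t x Ux) => V Vx r; exists V, Vx, r.
(* Subtract the image of a section [r] of [F] with the germ [t x] at [x]. *)
have hU := @opensIl _ U V; have hV := @opensIr _ U V.
have Wx : oset (opensI U V) x by [].
exists (opensI U V), Wx, (res (disc F) hU t - cmU (disc_unit F) _ (res F hV r)).
split.
  rewrite raddfB god_proj_unit subr0 -res_cmU germ_res; congr (germ _ _).
  congr (cmU (sheafify_unit _) U _); congr (piz _ _).
  by rewrite [RHS]res_id.
rewrite [LHS](_ : _ = t x (hU x Wx) - germ Wx (res F hV r)).
  by rewrite (germ_res hV Vx Wx) (Prop_irrelevance (hU x Wx) Ux) er subrr.
congr (_ - _); congr (germ _ _); exact: Prop_irrelevance.
Qed.

Lemma godQ_stalk_eq0 (F : presheaf X) x (U : opens X) (Ux : oset U x) (t : disc F U) :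
    germ Ux (cmU (god_proj 0 F) U t) = 0 -> t x Ux = 0 -> germ Ux t = 0.
Proof.
pose t' := cmU (coker_proj (disc_unit F)) U t.
move=> /(@germ_sheafify_eq0 _ _ _ Ux t')/germ_eq0[W [hW [Wx]]]; rewrite {}/t'.
rewrite res_cmU => /piz_eq0P/imzP[s]; rewrite [RHS]res_id => es tx.
rewrite -(germ_res hW Ux Wx) -es.
have : germ Wx s = 0.
  transitivity (cmU (disc_unit F) W s x Wx).
    by congr (germ _ _); apply: Prop_irrelevance.
  rewrite es -[RHS]tx; congr (t x); exact: Prop_irrelevance.
case/germ_eq0 => V [hV [Vx e]].
by rewrite -(germ_res hV Wx Vx) res_cmU e !raddf0.
Qed.

Section GodQExact.
Variables (F G : presheaf X) (k : psh_morph F G).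

Lemma godQ_stalkE x (U : opens X) (Ux : oset U x) (t : disc F U) :
  stalk_map (godQ_map k) (y := x) (germ Ux (cmU (god_proj 0 F) U t)) =
  germ Ux (cmU (god_proj 0 G) U (cmU (disc_map k) U t)).
Proof.
rewrite (stalk_mapE (godQ_map k) (@subset_refl _ U) Ux Ux); congr (germ _ _).
exact: (@god_proj_nat _ _ _ _ _ k 0).
Qed.

Lemma godQ_inj : stalk_inj k -> stalk_inj (godQ_map k).
Proof.
move=> inj x u; have [U [Ux [t [-> tx]]]] := godQ_stalk_rep u.
rewrite godQ_stalkE => /godQ_stalk_eq0; rewrite cmU_discE tx raddf0 => /(_ erefl).
case/germ_eq0=> W [h [Wx]]; rewrite res_cmU => /(disc_inj inj) e.
by rewrite -(germ_res h Ux Wx) res_cmU e !raddf0.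
Qed.

Lemma godQ_surj : stalk_surj k -> stalk_surj (godQ_map k).
Proof.
move=> surj x u; have [U [Ux [t [-> _]]]] := godQ_stalk_rep u.
have [s <-] := disc_surj surj t.
by exists (germ Ux (cmU (god_proj 0 F) U s)); rewrite godQ_stalkE.
Qed.
End GodQExact.

Lemma godQ_exact (E F G : presheaf X) (a : psh_morph E F) (k : psh_morph F G) :
  stalk_exact a k -> stalk_exact (godQ_map a) (godQ_map k).
Proof.
move=> ex x u; have [U [Ux [t [-> tx]]]] := godQ_stalk_rep u.
rewrite godQ_stalkE => /godQ_stalk_eq0; rewrite cmU_discE tx raddf0 => /(_ erefl).
case/germ_eq0=> W [h [Wx]]; rewrite res_cmU => /(disc_exact ex)[s es].
exists (germ Wx (cmU (god_proj 0 E) W s)); rewrite godQ_stalkE es.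
by rewrite -res_cmU germ_res.
Qed.

Lemma godA_inj (F G : presheaf X) (k : psh_morph F G) p : stalk_inj k ->
  forall (U : opens X) (s : godA p F U), cmU (godA_map k p) U s = 0 -> s = 0.
Proof.
move=> inj; apply: disc_inj; elim: p => [//|p IHp]; exact: godQ_inj.
Qed.

Lemma godA_surj (F G : presheaf X) (k : psh_morph F G) p : stalk_surj k ->
  forall (U : opens X) (t : godA p G U), exists s, cmU (godA_map k p) U s = t.
Proof.
move=> surj; apply: disc_surj; elim: p => [//|p IHp]; exact: godQ_surj.
Qed.

Lemma godA_exact (E F G : presheaf X) (a : psh_morph E F) (k : psh_morph F G) p :
    stalk_exact a k ->
  forall (U : opens X) (t : godA p F U), cmU (godA_map k p) U t = 0 ->
    exists s, cmU (godA_map a p) U s = t.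
Proof.
move=> ex; apply: disc_exact; elim: p => [//|p IHp]; exact: godQ_exact.
Qed.
End Exactness.

(** * Cocycles and cohomology sheaves of a complex *)

Section CocycleSheaf.
Variables (X : topologicalType) (K : pcomplex X).

Lemma cocycle_inclE q (U : opens X) (s : cocycle_presheaf K q U) :
  cmU (cocycle_incl K q) U s = val s.
Proof. exact: res_id. Qed.

Lemma cocycle_incl_comp0 q : comp0 (cocycle_incl K q) (pd K q).
Proof. by move=> U s; rewrite cocycle_inclE; apply/eqP; apply: (valP s). Qed.

Lemma stalk_inj_cocycle_incl q : stalk_inj (cocycle_incl K q).
Proof.
move=> x; elim/stalk_ind => U Ux s.
rewrite (stalk_mapE (cocycle_incl K q) (@subset_refl _ U) Ux Ux) => /germ_eq0[V [h [Vx]]].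
rewrite [cm _ _ _]cocycle_inclE => e; apply/germ_eq0; exists V, h; split=> //.
exact: val_inj.
Qed.

Lemma stalk_exact_cocycle_incl q : stalk_exact (cocycle_incl K q) (pd K q).
Proof.
move=> x; elim/stalk_ind => U Ux s.
rewrite (stalk_mapE (pd K q) (@subset_refl _ U) Ux Ux) => /germ_eq0[V [h [Vx]]].
rewrite [cm _ _ _]/(cmU _ _ _) res_cmU => /eqP e.
pose z : cocycle_presheaf K q V := exist _ (res (K q) h s) e.
exists (germ Vx z); rewrite (stalk_mapE (cocycle_incl K q) (@subset_refl _ V) Vx Vx).
by rewrite [cm _ _ _]cocycle_inclE /= germ_res.
Qed.

Lemma cmU_cocycle_proj q (U : opens X) (s : cocycle_presheaf K q U) :
  cmU (cocycle_proj K q) U s =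
  cmU (sheafify_unit (coh_presheaf K q)) U (@coclass (sections K U) q s).
Proof.
rewrite [LHS](_ : _ = cmU (sheafify_unit _) U (cmU (cocycle_class K q) U s)) //.
congr (cmU (sheafify_unit (coh_presheaf K q)) U _); congr (piz _ _).
exact: (@res_id _ (cocycle_presheaf K q)).
Qed.

Lemma stalk_surj_cocycle_proj q : stalk_surj (cocycle_proj K q).
Proof.
move=> x u; have [U [Ux [s ->]]] := stalk_sheafify_surj u.
rewrite -[s]pizP; move: (repr s) => {}s; exists (germ Ux (s : cocycle_presheaf K q U)).
rewrite (stalk_mapE (cocycle_proj K q) (@subset_refl _ U) Ux Ux).
by rewrite [cm _ _ _]cmU_cocycle_proj.
Qed.

Lemma stalk_cocycle_proj_eq0 q x (U : opens X) (Ux : oset U x)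
    (s : cocycle_presheaf K q U) :
  stalk_map (cocycle_proj K q) (y := x) (germ Ux s) = 0 ->
  exists (V : opens X) (h : V `<=` U),
    oset V x /\ res (K q) h (val s) \in cobound (sections K V) q.
Proof.
rewrite (stalk_mapE (cocycle_proj K q) (@subset_refl _ U) Ux Ux).
rewrite [cm _ _ _]cmU_cocycle_proj => /germ_sheafify_eq0/germ_eq0[V [h [Vx e]]].
by exists V, h; split=> //; move: e; rewrite [LHS]quot_mapE => /piz_eq0P.
Qed.

Lemma stalk_inj_cocycle_proj0 : stalk_inj (cocycle_proj K 0).
Proof.
move=> x; elim/stalk_ind => U Ux s /stalk_cocycle_proj_eq0[V [h [Vx /eqP e]]].
by apply/germ_eq0; exists V, h; split=> //; apply: val_inj.
Qed.

Variable q : nat.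

Fact cocycle_diff_sub (U : opens X) (s : K q U) :
  cmU (pd K q) U s \in kerz (cmU (pd K q.+1) U).
Proof. by rewrite inE pdK. Qed.
Definition cocycle_diff_sec (U V : opens X) (h : V `<=` idfun @^-1` U) (s : K q U) :
  cocycle_presheaf K q.+1 V :=
  exist _ (cmU (pd K q) V (res (K q) h s)) (cocycle_diff_sub (res (K q) h s)).
Fact cocycle_diff_additive (U V : opens X) (h : V `<=` idfun @^-1` U) :
  zmod_morphism (cocycle_diff_sec h).
Proof. by move=> s t; apply: val_inj; rewrite /= !raddfB. Qed.
HB.instance Definition _ (U V : opens X) (h : V `<=` idfun @^-1` U) :=
  GRing.isZmodMorphism.Build (K q U) (cocycle_presheaf K q.+1 V) (cocycle_diff_sec h)
    (cocycle_diff_additive h).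
Fact cocycle_diff_res (U U' V V' : opens X) (h : V `<=` idfun @^-1` U)
    (h' : V' `<=` idfun @^-1` U') (hU : U' `<=` U) (hV : V' `<=` V) (s : K q U) :
  res (cocycle_presheaf K q.+1) hV (cocycle_diff_sec h s) =
  cocycle_diff_sec h' (res (K q) hU s).
Proof.
by apply: val_inj; rewrite /= res_cmU !(res_comp _ _ (subset_trans hV h)).
Qed.
Definition cocycle_diff : psh_morph (K q) (cocycle_presheaf K q.+1) :=
  @Comorph X X (cidfun X) (K q) (cocycle_presheaf K q.+1)
    (fun U V h => cocycle_diff_sec h) cocycle_diff_res.

Lemma val_cocycle_diff (U : opens X) (s : K q U) :
  val (cmU cocycle_diff U s) = cmU (pd K q) U s.
Proof. by rewrite /= res_id. Qed.

Lemma cocycle_diff_incl :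
  square cocycle_diff (pd K q) (psh_id (K q)) (cocycle_incl K q.+1).
Proof.
move=> U V h s; rewrite -res_cmU [LHS](_ : _ = res _ h (val (cmU cocycle_diff U s))) //.
by rewrite val_cocycle_diff.
Qed.

Lemma cocycle_diff_comp0 : comp0 cocycle_diff (cocycle_proj K q.+1).
Proof.
move=> U s; rewrite cmU_cocycle_proj (_ : coclass _ = 0) ?raddf0 //.
by apply/piz_eq0P/imzP; exists s; rewrite -val_cocycle_diff.
Qed.

Lemma stalk_exact_cocycle_diff : stalk_exact cocycle_diff (cocycle_proj K q.+1).
Proof.
move=> x; elim/stalk_ind => U Ux s /stalk_cocycle_proj_eq0[V [h [Vx /imzP[t et]]]].
exists (germ Vx (t : K q V)); rewrite (stalk_mapE cocycle_diff (@subset_refl _ V) Vx Vx).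
rewrite -(germ_res h Ux Vx); congr (germ _ _); apply: val_inj.
by rewrite [LHS]val_cocycle_diff [LHS]et.
Qed.
End CocycleSheaf.

Section CocycleMap.
Variables (X Y : topologicalType) (g : continuousType Y X).
Variables (K : pcomplex X) (L : pcomplex Y) (f : pcomap g K L) (q : nat).

Fact cocycle_map_sub (U : opens X) (V : opens Y) (h : V `<=` g @^-1` U) s :
  s \in kerz (cmU (pd K q) U) -> cm (f q) h s \in kerz (cmU (pd L q) V).
Proof. by rewrite !inE -pcm_d => /eqP->; rewrite raddf0. Qed.
Fact cocycle_map_res (U U' : opens X) (V V' : opens Y) (h : V `<=` g @^-1` U)
    (h' : V' `<=` g @^-1` U') (hU : U' `<=` U) (hV : V' `<=` V)
    (s : cocycle_presheaf K q U) :
  res (cocycle_presheaf L q) hV (subz_map (@cocycle_map_sub U V h) s) =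
  subz_map (@cocycle_map_sub U' V' h') (res (cocycle_presheaf K q) hU s).
Proof. by apply: val_inj; apply: cm_res. Qed.
Definition cocycle_presheaf_map :
    comorph g (cocycle_presheaf K q) (cocycle_presheaf L q) :=
  @Comorph X Y g (cocycle_presheaf K q) (cocycle_presheaf L q)
    (fun U V h => subz_map (@cocycle_map_sub U V h)) cocycle_map_res.

Lemma square_cocycle_incl :
  square (cocycle_incl K q) (cocycle_incl L q) cocycle_presheaf_map (f q).
Proof. by move=> U V h s; rewrite !cocycle_inclE. Qed.

Lemma square_cocycle_proj :
  square (cocycle_proj K q) (cocycle_proj L q) cocycle_presheaf_map (coh_sheaf_map f q).
Proof.
move=> U V h s; rewrite !cmU_cocycle_proj [LHS]sheafify_unit_nat.
congr (cmU _ _ _); rewrite [LHS]quot_mapE; congr (piz _ _); exact: val_inj.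
Qed.
End CocycleMap.

(** * The second term of the Leray spectral sequence *)

Section LerayE2.
Variables (M N : topologicalType) (f : continuousType M N) (S : presheaf M).
Local Notation K := (leray_complex f S).
Local Notation T := (opensT N).
Variable q : nat.

Local Notation Z := (sections (godement (cocycle_presheaf K q)) T).
Local Notation H := (sections (godement (higher_image f S q)) T).

Definition leray_incl p : {additive Z p -> leray_double f S p q} :=
  cmU (godA_map (cocycle_incl K q) p) T.
Definition leray_proj : chain_map Z H :=
  sections_map (godement_map (cocycle_proj K q)) (@subset_refl _ T).

Lemma leray_incl_del p z :
  leray_incl p.+1 (cdiff Z p z) = del (leray_double f S) p q (leray_incl p z).
Proof. exact: god_diff_nat. Qed.

Lemma leray_incl_im p a :
  delbar (leray_double f S) p q a = 0 <-> exists z, leray_incl p z = a.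
Proof.
split=> [|[z <-]]; first exact: (godA_exact (@stalk_exact_cocycle_incl _ K q)).
exact: (godA_comp0 (@cocycle_incl_comp0 _ K q)).
Qed.

Lemma leray_proj_surj p h : exists z, leray_proj p z = h.
Proof. exact: (godA_surj (@stalk_surj_cocycle_proj _ K q)). Qed.
End LerayE2.

(** For [q > 0], [delbar] factors through [cocycle_diff : K^(q-1) -> Z^q], whose image is
    the kernel of the projection to the cohomology sheaf; for [q = 0] that projection is
    injective on stalks. *)
Lemma leray_proj_ker (M N : topologicalType) (f : continuousType M N) (S : presheaf M)
    q p (z : godA p (cocycle_presheaf (leray_complex f S) q) (opensT N)) :
  leray_proj f S q p z = 0 <->
  leray_incl f S q p z \in cobound (column (leray_double f S) p) q.
Proof.
set K := leray_complex f S in z *; case: q z => [|q] z.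
  have c0 := @cobound0P (column (leray_double f S) p); split=> [e|/c0 e].
    suff -> : z = 0 by rewrite raddf0 rpred0.
    exact: (godA_inj (@stalk_inj_cocycle_proj0 _ K) e).
  suff -> : z = 0 by rewrite raddf0.
  exact: (godA_inj (@stalk_inj_cocycle_incl _ K 0) e).
have dE u : leray_incl f S q.+1 p (cmU (godA_map (cocycle_diff K q) p) (opensT N) u) =
    delbar (leray_double f S) p q u.
  rewrite [LHS](square_godA (@cocycle_diff_incl _ K q)).
  by congr (cmU _ _ _); apply: (is_id_godA (@psh_id_is_id _ (K q))).
split=> [|/imzP[u]].
  case/(godA_exact (@stalk_exact_cocycle_diff _ K q)) => u eu.
  by apply/imzP; exists u; rewrite -eu dE.
rewrite [LHS](_ : _ = delbar (leray_double f S) p q u) // -dE => /eqP.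
rewrite eq_sym -subr_eq0 -raddfB => /eqP/(godA_inj (@stalk_inj_cocycle_incl _ K q.+1)).
move=> /eqP; rewrite subr_eq0 => /eqP->.
exact: (godA_comp0 (@cocycle_diff_comp0 _ K q)).
Qed.

Lemma leray_E2_isoP (M N : topologicalType) (f : continuousType M N) (S : presheaf M)
    p q n : (p + q = n)%N ->
  exists (iota : {additive lerayE f S 2 p n -> sheaf_coh p (higher_image f S q)})
         (kappa : {additive sheaf_coh p (higher_image f S q) -> lerayE f S 2 p n}),
    leray_E2_iso iota /\ cancel iota kappa.
Proof.
move=> pqn; have [iota [kappa [Ri iK kK]]] := E2_rel_iso (@leray_incl_del _ _ f S q)
  (@leray_incl_im _ _ f S q) (@leray_proj_surj _ _ f S q) (@leray_proj_ker _ _ f S q) pqn.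
by exists iota, kappa; split=> //; split=> //; exists kappa.
Qed.

(** * Restriction to an open subset *)

Section LerayRestriction.
Variables (M N : topologicalType) (f : continuousType M N) (N' : opens N).
Variable S : presheaf M.
Local Notation f' := (restrict_map f N').
Local Notation S' := (open_restr (opensV f N') S).
Local Notation j := (subsp_incl N').
Local Notation K := (leray_complex f S).
Local Notation K' := (leray_complex f' S').

Definition leray_complex_res : pcomap j K K' :=
  direct_image_complex_map (@restrict_mapE M N f N')
    (godement_map (open_restr_unit (opensV f N') S)).

Let jT : opensT (subsp N') `<=` j @^-1` opensT N := fun _ _ => I.

Definition leray_double_res p q :
    {additive leray_double f S p q -> leray_double f' S' p q} :=
  cm (godA_map (leray_complex_res q) p) jT.

Lemma leray_double_res_del p q x :
  leray_double_res p.+1 q (del (leray_double f S) p q x) =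
  del (leray_double f' S') p q (leray_double_res p q x).
Proof. exact: god_diff_nat. Qed.

Lemma leray_double_res_delbar p q x :
  leray_double_res p q.+1 (delbar (leray_double f S) p q x) =
  delbar (leray_double f' S') p q (leray_double_res p q x).
Proof.
have sq : square (pd K q) (pd K' q) (leray_complex_res q) (leray_complex_res q.+1).
  by move=> U V h s; apply: pcm_d.
exact: (square_godA sq).
Qed.

Definition lerayE_res r p n : {additive lerayE f S r p n -> lerayE f' S' r p n} :=
  @ssE_map (total_complex (leray_double f S)) (total_complex (leray_double f' S'))
    (total_map leray_double_res) (total_map_diff leray_double_res_del leray_double_res_delbar)
    (@total_map_filt _ _ leray_double_res) r p n.

(** [leray_restriction] passes through the cohomology of [(R^q f_* S)|_N'], whereas
    witnesses over [N] are carried to [N'] in one step; both are induced by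
    [higher_image_res], which factors through the restricted sheaf. *)
Lemma leray_restriction_class p q
    (c : cocycle (sections (godement (higher_image f S q)) (opensT N)) p) :
  leray_restriction f N' S p q (coclass c) =
  coclass (cocycle_map (sections_map (godement_map (higher_image_res f N' S q)) jT) p c).
Proof.
rewrite [LHS](_ : _ = sheaf_coh_map p (higher_image_iso f N' S q)
  (sheaf_coh_map p (open_restr_unit N' (higher_image f S q)) (coclass c))) //.
rewrite [sheaf_coh_map _ _ (coclass c)]quot_mapE [LHS]quot_mapE.
congr (piz _ _); apply: val_inj.
have sq : square (psh_id (higher_image f S q)) (higher_image_iso f N' S q)
    (open_restr_unit N' (higher_image f S q)) (higher_image_res f N' S q).
  move=> U V h s; rewrite [cmU (psh_id _) _ _]res_id.
  by rewrite -[LHS](res_id (@subset_refl _ V)); apply: cm_res.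
have := square_godA sq jT (val c).
rewrite [cmU _ _ (val c)](is_id_godA (@psh_id_is_id _ _)) => e.
by rewrite [RHS]/= e; congr (cm _ _ (cm _ _ _)); apply: Prop_irrelevance.
Qed.

(** Each of the four equations of the relation is carried over by a commutative square:
    of filtered complexes for the class in [E_2], of cocycle presheaves for the leading
    term, of cohomology sheaves for its projection. *)
Lemma leray_E2_rel_res p q n x y : @leray_E2_rel M N f S p q n x y ->
  leray_E2_rel (lerayE_res 2 p n x) (leray_restriction f N' S p q y).
Proof.
move=> [a [z [c [<- ez ec <-]]]].
eexists; exists (cm (godA_map (cocycle_presheaf_map leray_complex_res q) p) jT z).
exists (cocycle_map (sections_map (godement_map (higher_image_res f N' S q)) jT) p c).
split; first by rewrite [RHS]ssE_map_class.
- rewrite -(square_godA (@square_cocycle_incl _ _ _ _ _ leray_complex_res q) jT).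
  by rewrite ez.
- rewrite -(square_godA (@square_cocycle_proj _ _ _ _ _ leray_complex_res q) jT).
  by rewrite ec.
- by rewrite leray_restriction_class.
Qed.

Lemma leray_E2_iso_res p q n
    (iota : {additive lerayE f S 2 p n -> sheaf_coh p (higher_image f S q)})
    (iota' : {additive lerayE f' S' 2 p n -> sheaf_coh p (higher_image f' S' q)}) :
  leray_E2_iso iota -> leray_E2_iso iota' ->
  forall x, leray_restriction f N' S p q (iota x) = iota' (lerayE_res 2 p n x).
Proof.
move=> [_ Ri] [_ Ri'] x; apply/esym/Ri'; apply: leray_E2_rel_res; exact/Ri.
Qed.
End LerayRestriction.

Theorem theorem1p5 (M N : topologicalType) (f : continuousType M N)
    (S : presheaf M) (sheafS : is_sheaf S) (N' : opens N) (p q : nat) (q_ge1 : (1 <= q)%N) :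
  exists (d2 : {additive sheaf_coh p (higher_image f S q) ->
                         sheaf_coh (p + 2) (higher_image f S (q - 1))})
         (d2' : {additive
            sheaf_coh p (higher_image (restrict_map f N') (open_restr (opensV f N') S) q) ->
            sheaf_coh (p + 2)
              (higher_image (restrict_map f N') (open_restr (opensV f N') S) (q - 1))}),
    [/\ is_leray_d2 d2, is_leray_d2 d2' &
        forall x, leray_restriction f N' S (p + 2) (q - 1) (d2 x) =
                  d2' (leray_restriction f N' S p q x)].
Proof.
have qn : (p + 2 + (q - 1) = (p + q).+1)%N by rewrite -addnA subn1 addSn add1n prednK ?addnS.
pose S' := open_restr (opensV f N') S; pose f' := restrict_map f N'.
have [i [k [iP iK]]] := @leray_E2_isoP _ _ f S p q (p + q) erefl.
have [j [_ [jP _]]] := @leray_E2_isoP _ _ f S (p + 2) (q - 1) (p + q).+1 qn.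
have [i' [k' [iP' iK']]] := @leray_E2_isoP _ _ f' S' p q (p + q) erefl.
have [j' [_ [jP' _]]] := @leray_E2_isoP _ _ f' S' (p + 2) (q - 1) (p + q).+1 qn.
pose d := leray_d f S 2 p (p + q); pose d' := leray_d f' S' 2 p (p + q).
exists ((j \o d) \o k)%FUN, ((j' \o d') \o k')%FUN; split.
- by exists i, j; split; [| |move=> x; apply: (congr1 (fun z => j (d z)) (iK x))].
- by exists i', j'; split; [| |move=> x; apply: (congr1 (fun z => j' (d' z)) (iK' x))].
move=> y; have [[h _ iH] _] := iP; rewrite -[y]iH; move: (h y) => {h iH}y.
rewrite (leray_E2_iso_res iP iP').
transitivity (leray_restriction f N' S (p + 2) (q - 1) (j (d y))).
  by congr (leray_restriction _ _ _ _ _ (j (d _))); apply: iK.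
rewrite (leray_E2_iso_res jP jP').
transitivity (j' (d' (lerayE_res f N' S 2 p (p + q) y))).
  by congr (j' _); apply: ssE_map_d.
by congr (j' (d' _)); rewrite iK'.
Qed.
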